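(* Let $W=\mathcal S_n$, $S=\{s_1,\dots,s_{n-1}\}$, $J'_{n-2}=\{s_3,\dots,s_{n-1}\}$, $\mathscr H$ the Hecke algebra of $W$, and $\Gamma$ a $W$-graph. Let $$\tilde\beta:\mathscr H\otimes_{J'_{n-2}}A\Gamma\to\mathscr H\otimes_{S\setminus s_2}A\Gamma,\qquad h\boxtimes e\mapsto h\boxtimes e,$$ be the natural projection, and let $\mathscr L^*$ be the $A^-$-span of the canonical basis elements $\tilde C'_{w,\gamma}\in\mathscr H\otimes_{S\setminus s_2}A\Gamma$ with $w\in W^{S\setminus s_2}$ and $s_1\in L(\gamma)$. Then for every $w\in W^{S\setminus s_2}$ and $\gamma\in\Gamma$, the map $\tilde\beta$ satisfies, on canonical basis elements, $$\begin{array}{rcll} \tilde C'_{ws_1,\gamma}&\longmapsto&[2]\,\tilde C'_{w,\gamma}&\text{if }s_1\in L(\gamma),\\ \tilde C'_{w,\gamma}&\longmapsto&0\bmod\mathscr L^*&\text{if }s_1\in L(\gamma),\\ \tilde C'_{ws_1,\gamma}&\longmapsto&0\bmod\mathscr L^*&\text{if }s_1\notin L(\gamma),\\ \tilde C'_{w,\gamma}&\longmapsto&\tilde C'_{w,\gamma}\bmod\mathscr L^*&\text{if }s_1\notin L(\gamma). \end{array}$$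
   Context: Let $A=\mathbb Z[u,u^{-1}]$, $A^-=\mathbb Z[u^{-1}]$, $\bar u=u^{-1}$, $[2]=u+u^{-1}$. The Hecke algebra $\mathscr H$ of $(W,S)$ is the free $A$-module on $\{T_w\}$ with $T_vT_w=T_{vw}$ if $\ell(vw)=\ell(v)+\ell(w)$ and $(T_s-u)(T_s+u^{-1})=0$; $\bar{\cdot}$ is the semilinear involution with $\overline{T_w}=T_{w^{-1}}^{-1}$; $C'_s=T_s+u^{-1}$. For $K\subseteq S$, $W_K$ is the parabolic subgroup, $\mathscr H_K$ its Hecke algebra, $W^K$ the minimal length representatives of cosets $wW_K$; $S\setminus s_2$ means $S\setminus\{s_2\}$. One has $W^{J'_{n-2}}=W^{S\setminus s_2}\sqcup W^{S\setminus s_2}s_1$. A $W$-graph is a set $\Gamma$ with weights $\mu(\delta,\gamma)\in\mathbb Z$ and descent sets $L(\gamma)\subseteq S$ such that $A\Gamma$ is a left $\mathscr H$-module via $C'_s\gamma=[2]\gamma$ if $s\in L(\gamma)$ and $C'_s\gamma=\sum_{\delta:s\in L(\delta)}\mu(\delta,\gamma)\delta$ otherwise; $A\Gamma$ carries the semilinear involution $\bar{\cdot}$ fixing $\Gamma$. Restricting to $\mathscr H_K$ gives a $W_K$-graph. Write $\mathscr H\otimes_K E:=\mathscr H\otimes_{\mathscr H_K}E$ with pure tensors $h\boxtimes e$. For a $W_K$-graph $\Gamma$, $\mathscr H\otimes_K A\Gamma$ has involution $\overline{h\boxtimes e}=\bar h\boxtimes\bar e$ and a unique $\bar{\cdot}$-invariant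 basis (the canonical basis) $\tilde C'_{w,\gamma}$ ($w\in W^K$, $\gamma\in\Gamma$) with $\tilde C'_{w,\gamma}\equiv T_w\boxtimes\gamma\bmod u^{-1}A^-\{T_x\boxtimes\delta:x\in W^K,\delta\in\Gamma\}$ (Howlett-Yin). In the displayed formulas the left-hand elements are canonical basis elements of $\mathscr H\otimes_{J'_{n-2}}A\Gamma$ and the right-hand ones are canonical basis elements of $\mathscr H\otimes_{S\setminus s_2}A\Gamma$; ''$\mapsto y\bmod\mathscr L^*$'' means that the image differs from $y$ by an element of $\mathscr L^*$. *)

(* Defs.v *)
From HB Require Import structures.
From mathcomp Require Import all_boot all_order all_algebra all_fingroup.
From mathcomp Require Import finmap ring zify.
From mathcomp.multinomials Require Import monalg.
From mathcomp.classical Require Import boolp.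

Set Implicit Arguments.
Unset Strict Implicit.
Unset Printing Implicit Defensive.

Import GRing.Theory.
Local Open Scope ring_scope.

(* ------------------------------------------------------------------------ *)
(* A = Z[u, u^-1], as finitely supported functions k |-> (coefficient of     *)
(* u^k) with the convolution product.  The instance {malg int[K]} of monalg  *)
(* does not apply: its monoids K have no invertible element but the unit.    *)

Local Notation lpoly := {malg int[int]}.

Section LaurentRing.
Implicit Types f g h : lpoly.

Definition laurent_one : lpoly := << 1 *g 0 >>.

Definition laurent_mul f g : lpoly :=
  \sum_(i <- msupp f) \sum_(j <- msupp g) << f@_i * g@_j *g i + j >>.

Lemma laurent_mulw (d1 d2 : {fset int}) f g :
  (msupp f `<=` d1)%fset -> (msupp g `<=` d2)%fset ->
  laurent_mul f g = \sum_(i <- d1) \sum_(j <- d2) << f@_i * g@_j *g i + j >>.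
Proof.
move=> le1 le2; rewrite /laurent_mul (big_fset_incl _ le1) /=.
  apply/eq_bigr=> i _; apply/big_fset_incl => // k _ /mcoeff_outdom ->.
  by rewrite mulr0 monalgU0.
move=> k _ /mcoeff_outdom fk; rewrite big1 // => j _.
by rewrite fk mul0r monalgU0.
Qed.

Lemma laurent_mulUU (a b : int) (i j : int) :
  laurent_mul << a *g i >> << b *g j >> = << a * b *g i + j >>.
Proof. by rewrite (laurent_mulw msuppU_le msuppU_le) !big_seq_fset1 !mcoeffUU. Qed.

Lemma laurent_mulDl : left_distributive laurent_mul +%R.
Proof.
move=> f g h.
rewrite (laurent_mulw (fsubsetUl (msupp f) (msupp g)) (fsubset_refl (msupp h))).
rewrite (laurent_mulw (fsubsetUr (msupp f) (msupp g)) (fsubset_refl (msupp h))).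
rewrite (laurent_mulw (msuppD_le f g) (fsubset_refl (msupp h))).
rewrite -big_split /=; apply/eq_bigr=> i _.
rewrite -big_split /=; apply/eq_bigr=> j _.
by rewrite mcoeffD mulrDl monalgUD.
Qed.

Lemma laurent_mulC : commutative laurent_mul.
Proof.
move=> f g; rewrite /laurent_mul exchange_big /=.
apply/eq_bigr => j _; apply/eq_bigr => i _.
by rewrite mulrC [j + i]addrC.
Qed.

Lemma laurent_mulDr : right_distributive laurent_mul +%R.
Proof. by move=> f g h; rewrite laurent_mulC laurent_mulDl !(laurent_mulC f). Qed.

Lemma laurent_mul0l g : laurent_mul 0 g = 0.
Proof. by rewrite /laurent_mul msupp0 big_seq_fset0. Qed.

Lemma laurent_mul0r g : laurent_mul g 0 = 0.
Proof. by rewrite laurent_mulC laurent_mul0l. Qed.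

Lemma laurent_mul_suml (I : Type) (r : seq I) (F : I -> lpoly) g :
  laurent_mul (\sum_(i <- r) F i) g = \sum_(i <- r) laurent_mul (F i) g.
Proof.
exact: (big_morph (laurent_mul^~ g) (fun x y => laurent_mulDl x y g)
         (laurent_mul0l g)).
Qed.

Lemma laurent_mulEl f g :
  laurent_mul f g = \sum_(i <- msupp f) laurent_mul << f@_i *g i >> g.
Proof. by rewrite {1}[f]monalgE laurent_mul_suml. Qed.

Lemma laurent_mul_sumr (I : Type) (r : seq I) (F : I -> lpoly) g :
  laurent_mul g (\sum_(i <- r) F i) = \sum_(i <- r) laurent_mul g (F i).
Proof.
by rewrite laurent_mulC laurent_mul_suml; apply/eq_bigr => i _; apply: laurent_mulC.
Qed.

Lemma laurent_mulA : associative laurent_mul.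
Proof.
move=> f g h; rewrite (laurent_mulEl f (laurent_mul g h)) (laurent_mulEl f g).
rewrite laurent_mul_suml; apply/eq_bigr => i _; set F := mkmalgU _ _.
rewrite (laurent_mulC F g) (laurent_mulEl g h) (laurent_mulEl g F).
rewrite laurent_mul_suml laurent_mul_sumr; apply/eq_bigr => j _.
set G := mkmalgU _ _; rewrite (laurent_mulC G h) (laurent_mulC _ h).
rewrite (laurent_mulEl h G) (laurent_mulEl h) laurent_mul_sumr.
apply/eq_bigr => k _; rewrite !laurent_mulUU.
by congr (mkmalgU _ _); ring.
Qed.

Lemma laurent_mul1 : left_id laurent_one laurent_mul.
Proof.
move=> f; rewrite (laurent_mulw msuppU_le (fsubset_refl _)) big_seq_fset1.
rewrite [RHS]monalgE; apply/eq_bigr => j _.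
by rewrite mcoeffUU mul1r add0r.
Qed.

Lemma laurent_one_neq0 : laurent_one != 0.
Proof. by rewrite /laurent_one monalgU_eq0. Qed.

End LaurentRing.

Record laurent := Laurent { lcoef : lpoly }.
HB.instance Definition _ := [isNew for lcoef].
HB.instance Definition _ := [Choice of laurent by <:].

Section LaurentInstances.
Implicit Types f g h : laurent.

Let add f g := Laurent (lcoef f + lcoef g).
Let opp f := Laurent (- lcoef f).
Let mul f g := Laurent (laurent_mul (lcoef f) (lcoef g)).

Fact laurent_addA : associative add.
Proof. by move=> f g h; congr Laurent; apply: addrA. Qed.
Fact laurent_addC : commutative add.
Proof. by move=> f g; congr Laurent; apply: addrC. Qed.
Fact laurent_add0 : left_id (Laurent 0) add.
Proof. by case=> f; congr Laurent; apply: add0r. Qed.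
Fact laurent_addN : left_inverse (Laurent 0) opp add.
Proof. by move=> f; congr Laurent; apply: addNr. Qed.

HB.instance Definition _ := GRing.isZmodule.Build laurent
  laurent_addA laurent_addC laurent_add0 laurent_addN.

Fact laurent_mulrA : associative mul.
Proof. by move=> f g h; congr Laurent; apply: laurent_mulA. Qed.
Fact laurent_mulrC : commutative mul.
Proof. by move=> f g; congr Laurent; apply: laurent_mulC. Qed.
Fact laurent_mul1r : left_id (Laurent laurent_one) mul.
Proof. by case=> f; congr Laurent; apply: laurent_mul1. Qed.
Fact laurent_mulrDl : left_distributive mul +%R.
Proof. by move=> f g h; congr Laurent; apply: laurent_mulDl. Qed.
Fact laurent_oner_neq0 : Laurent laurent_one != 0.
Proof. exact: laurent_one_neq0. Qed.

HB.instance Definition _ := GRing.Zmodule_isComNzRing.Build laurent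
  laurent_mulrA laurent_mulrC laurent_mul1r laurent_mulrDl laurent_oner_neq0.

End LaurentInstances.

Definition A : comNzRingType := laurent.

Definition coefu (k : int) (f : A) : int := (lcoef f)@_k.

Lemma coefuP (f g : A) : (forall k, coefu k f = coefu k g) <-> f = g.
Proof.
split=> [fg|-> //]; case: f g fg => [f] [g] fg.
by congr Laurent; apply/malgP.
Qed.

Definition upow (k : int) : A := Laurent << 1 *g k >>.
Notation u := (upow 1).
Notation uV := (upow (-1)).

Lemma upowD (i j : int) : upow (i + j) = upow i * upow j.
Proof. by congr Laurent; rewrite /= laurent_mulUU mulr1. Qed.

Lemma upow0 : upow 0 = 1. Proof. by []. Qed.

(* [2] = u + u^-1 *)
Definition qtwo : A := u + uV.

(* A^- = Z[u^-1] and u^-1 A^- *)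
Definition Aminus (f : A) : Prop := forall k : int, 0 < k -> coefu k f = 0.
Definition uVAminus (f : A) : Prop := exists2 g, Aminus g & f = uV * g.

(* ------------------------------------------------------------------------ *)
(* Additive maps determined by the values on the basis of a free A-module    *)
(* {malg A[K]}, semilinear with respect to sigma                       *)

Section SemiExt.
Variables (K : choiceType) (N : lmodType A).
Variables (sigma : {rmorphism A -> A}) (f : K -> N).

Definition semi_ext (x : {malg A[K]}) : N :=
  \sum_(k <- msupp x) sigma x@_k *: f k.

Lemma semi_extw (d : {fset K}) x : (msupp x `<=` d)%fset ->
  semi_ext x = \sum_(k <- d) sigma x@_k *: f k.
Proof.
move=> le; rewrite /semi_ext (big_fset_incl _ le) //= => k _ /mcoeff_outdom ->.
by rewrite rmorph0 scale0r.
Qed.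

Lemma semi_extD : {morph semi_ext : x y / x + y}.
Proof.
move=> x y; rewrite (semi_extw (fsubsetUl (msupp x) (msupp y))).
rewrite (semi_extw (fsubsetUr (msupp x) (msupp y))) (semi_extw (msuppD_le x y)).
by rewrite -big_split; apply/eq_bigr => k _; rewrite mcoeffD rmorphD scalerDl.
Qed.

Lemma semi_extZ a x : semi_ext (a *: x) = sigma a *: semi_ext x.
Proof.
rewrite (semi_extw (msuppZ_le a x)) /semi_ext scaler_sumr.
by apply/eq_bigr => k _; rewrite mcoeffZ rmorphM scalerA.
Qed.

Lemma semi_extU a k : semi_ext << a *g k >> = sigma a *: f k.
Proof. by rewrite (semi_extw msuppU_le) big_seq_fset1 mcoeffUU. Qed.

Lemma semi_ext0 : semi_ext 0 = 0.
Proof. by rewrite /semi_ext msupp0 big_seq_fset0. Qed.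

Lemma semi_extB : {morph semi_ext : x y / x - y}.
Proof. by move=> x y; rewrite semi_extD -[- y]scaleN1r semi_extZ rmorphN1 scaleN1r. Qed.

End SemiExt.

(* ------------------------------------------------------------------------ *)
(* The ring involution u |-> u^-1 of A                                       *)

Definition lpoly_bar (f : lpoly) : lpoly :=
  \sum_(k <- msupp f) << f@_k *g (- k)%R >>.

Lemma lpoly_barE f k : (lpoly_bar f)@_k = f@_(- k).
Proof.
rewrite [in RHS](monalgE f) /lpoly_bar !raddf_sum; apply/eq_bigr => i _ /=.
by rewrite !mcoeffU eqr_oppLR.
Qed.

Lemma lpoly_barU (a k : int) : lpoly_bar << a *g k >> = << a *g (- k)%R >>.
Proof. by apply/malgP => i; rewrite lpoly_barE !mcoeffU eqr_oppLR. Qed.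

Lemma lpoly_barD : {morph lpoly_bar : f g / f + g}.
Proof. by move=> f g; apply/malgP => k; rewrite !(lpoly_barE, mcoeffD). Qed.

Lemma lpoly_bar_sum (I : Type) (r : seq I) (F : I -> lpoly) :
  lpoly_bar (\sum_(i <- r) F i) = \sum_(i <- r) lpoly_bar (F i).
Proof.
by apply: (big_morph _ lpoly_barD); rewrite /lpoly_bar msupp0 big_seq_fset0.
Qed.

Lemma lpoly_barM f g :
  lpoly_bar (laurent_mul f g) = laurent_mul (lpoly_bar f) (lpoly_bar g).
Proof.
rewrite {1}/laurent_mul lpoly_bar_sum [lpoly_bar f]/lpoly_bar laurent_mul_suml.
apply/eq_bigr => i _; rewrite lpoly_bar_sum [lpoly_bar g]/lpoly_bar laurent_mul_sumr.
by apply/eq_bigr => j _; rewrite lpoly_barU laurent_mulUU opprD.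
Qed.

Definition lbar (f : A) : A := Laurent (lpoly_bar (lcoef f)).

Lemma lbarE f k : coefu k (lbar f) = coefu (- k) f.
Proof. exact: lpoly_barE. Qed.

Lemma lbarB : zmod_morphism lbar.
Proof.
by move=> f g; apply/coefuP => k; rewrite lbarE /coefu /= !mcoeffB !lpoly_barE.
Qed.

HB.instance Definition _ := GRing.isZmodMorphism.Build A A lbar lbarB.

Lemma lbarM : monoid_morphism lbar.
Proof.
split; first by congr Laurent; rewrite lpoly_barU oppr0.
by move=> f g; congr Laurent; apply: lpoly_barM.
Qed.

HB.instance Definition _ := GRing.isMonoidMorphism.Build A A lbar lbarM.

Lemma lbarK : involutive lbar.
Proof. by move=> f; apply/coefuP => k; rewrite !lbarE opprK. Qed.

Lemma lbar_upow k : lbar (upow k) = upow (- k).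
Proof. by congr Laurent; apply: lpoly_barU. Qed.

Lemma lbar_qtwo : lbar qtwo = qtwo.
Proof. by rewrite /qtwo rmorphD /= !lbar_upow opprK addrC. Qed.

(* ------------------------------------------------------------------------ *)
(* The Coxeter system (W, S) of the symmetric group on n = m + 2 letters:     *)
(* i : 'I_m.+1 stands for the simple reflection s_(i+1), which exchanges the  *)
(* letters i and i + 1 of {0, ..., n - 1}.  In the product v * w of 'S_n the   *)
(* left factor is applied first; inversion identifies this Coxeter system     *)
(* with the one for the opposite convention and fixes every s_i.              *)

Section Coxeter.
Variable m : nat.
Local Notation W := 'S_m.+2.
Local Notation S := 'I_m.+1.
Implicit Types (v w : W) (s : S) (K : {set S}).
Local Open Scope group_scope.

Definition simple s : W := tperm (widen_ord (leqnSn m.+1) s) (lift ord0 s).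

Definition word (t : seq S) : W := \prod_(s <- t) simple s.

Lemma word_exists w : exists t : seq S, word t = w.
Proof.
pose gens := [set simple s | s in [set: S]].
have tpA (k : nat) (lt_k : (k < m.+2)%N) : tperm ord0 (Ordinal lt_k) \in <<gens>>.
  elim: k lt_k => [|k IHk] lt_k.
    by rewrite (_ : Ordinal _ = ord0) ?tperm1 ?group1 //; apply: val_inj.
  case: k IHk lt_k => [|k] IHk lt_k.
    apply: mem_gen; apply/imsetP; exists ord0 => //; rewrite /simple.
    by congr tperm; apply: val_inj.
  have lt_k' : (k.+1 < m.+2)%N := ltnW lt_k.
  have lt_s : (k.+1 < m.+1)%N by [].
  pose a := Ordinal lt_k'; pose b := Ordinal lt_k.
  have sE : simple (Ordinal lt_s) = tperm a b.
    by rewrite /simple; congr tperm; apply: val_inj.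
  have -> : tperm ord0 b = tperm ord0 a ^ simple (Ordinal lt_s).
    rewrite sE tpermJ tpermL tpermD // -val_eqE /=; lia.
  apply: groupJ; first exact: IHk.
  by apply: mem_gen; apply/imsetP; exists (Ordinal lt_s).
have: w \in <<gens>>.
  have: w \in <<[set tperm ord0 y | y in 'I_m.+2]>>.
    by rewrite gen_tperm inE.
  apply/subsetP; rewrite gen_subG; apply/subsetP => x /imsetP[[k lt_k] _ ->].
  exact: tpA.
case/gen_prodgP => k [c cA ->].
have /fin_all_exists[f fE] (i : 'I_k) : exists s, c i = simple s.
  by have /imsetP[s _ ->] := cA i; exists s.
exists [seq f i | i <- index_enum (ordinal k)]; rewrite /word big_map.
by apply: eq_bigr => i _; rewrite fE.
Qed.

Lemma word_size_exists w :
  exists k, [exists t : k.-tuple S, word t == w].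
Proof.
have [t tw] := word_exists w.
by exists (size t); apply/existsP; exists (in_tuple t); rewrite tw.
Qed.

(* the Coxeter length l(w): the least length of a word in S representing w *)
Definition len w : nat := ex_minn (word_size_exists w).

Lemma lenP w : exists2 t, size t = len w & word t = w.
Proof.
rewrite /len; case: ex_minnP => k /existsP[t /eqP tw] _.
by exists t; rewrite ?size_tuple.
Qed.

Lemma len_le (t : seq S) : (len (word t) <= size t)%N.
Proof.
rewrite /len; case: ex_minnP => k _; apply.
by apply/existsP; exists (in_tuple t).
Qed.

Lemma simpleV s : (simple s)^-1 = simple s. Proof. exact: tpermV. Qed.

Lemma simple2 s : simple s * simple s = 1. Proof. exact: tperm2. Qed.

Lemma odd_simple s : odd_perm (simple s).
Proof.
by rewrite odd_tperm; apply/eqP => /(congr1 val) /=; rewrite /bump; lia.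
Qed.

Lemma odd_word (t : seq S) : odd_perm (word t) = odd (size t).
Proof.
elim: t => [|s t IHt]; first by rewrite /word big_nil odd_perm1.
by rewrite /word big_cons odd_permM -/(word t) IHt odd_simple.
Qed.

Lemma odd_len w : odd (len w) = odd_perm w.
Proof. by have [t <- tw] := lenP w; rewrite -odd_word tw. Qed.

Lemma len_simple_le s w : (len (simple s * w) <= (len w).+1)%N.
Proof.
have [t <- tw] := lenP w.
by have := len_le (s :: t); rewrite {1}/word big_cons -/(word t) tw.
Qed.

Lemma simpleK s w : simple s * (simple s * w) = w.
Proof. by rewrite mulgA simple2 mul1g. Qed.

Lemma len_simple s w :
  len (simple s * w) = (len w).+1 \/ len w = (len (simple s * w)).+1.
Proof.
have le1 := len_simple_le s w.
have le2 := len_simple_le s (simple s * w); rewrite simpleK in le2.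
have: odd (len (simple s * w)) != odd (len w).
  by rewrite !odd_len odd_permM odd_simple; case: (odd_perm w).
lia.
Qed.

Lemma len1 : len 1 = 0%N.
Proof. by have := len_le [::]; rewrite /word big_nil /=; lia. Qed.

Lemma len_simple1 s : len (simple s) = 1%N.
Proof. by have := len_simple s 1; rewrite mulg1 len1; case=> // . Qed.

Lemma word_rev (t : seq S) : word (rev t) = (word t)^-1.
Proof.
elim: t => [|s t IHt]; first by rewrite /word big_nil invg1.
rewrite rev_cons -cats1 /word big_cat /= big_seq1 -/(word (rev t)) IHt.
by rewrite big_cons invMg simpleV.
Qed.

Lemma lenV w : len w^-1 = len w.
Proof.
have le x : (len x^-1 <= len x)%N.
  have [t <- tx] := lenP x.
  by rewrite -(size_rev t) -tx -word_rev len_le.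
by apply/eqP; rewrite eqn_leq le -{1}[w]invgK le.
Qed.

Lemma len_descent w : w != 1 -> exists s, len w = (len (simple s * w)).+1.
Proof.
have [[|s t] /= tl tw] := lenP w; first by rewrite -tw /word big_nil eqxx.
move=> _; exists s; have := len_le t; have := len_simple s w.
have -> : simple s * w = word t by rewrite -tw /word big_cons simpleK.
by case; lia.
Qed.

(* W_K, and the set W^K of minimal length representatives of cosets w W_K *)
Definition parabolic K : {group W} := <<[set simple s | s in K]>>%G.

Definition minreps K : {set W} :=
  [set w | [forall x in parabolic K, (len w <= len (w * x))%N]].

End Coxeter.
Arguments simple {m} s.
Arguments len {m} w.
Arguments parabolic {m} K.
Arguments minreps {m} K.

(* ------------------------------------------------------------------------ *)
(* The Hecke algebra of (W, S): an A-algebra with A-basis (T_w) satisfying    *)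
(* the defining relations (such an algebra is unique up to isomorphism).      *)
(* hcoord gives the coordinates in the basis.  The carrier is a unitAlgType   *)
(* so that T_(w^-1)^-1 can be written with the inverse of the library.        *)

Structure heckeAlgebra (m : nat) := HeckeAlgebra {
  hecke_sort :> unitAlgType A;
  T : 'S_m.+2 -> hecke_sort;
  hcoord : hecke_sort -> {ffun 'S_m.+2 -> A};
  hcoordK : forall h : hecke_sort, \sum_w hcoord h w *: T w = h;
  hcoordE : forall c : {ffun 'S_m.+2 -> A},
    hcoord (\sum_w c w *: T w) = c;
  T_mul : forall v w : 'S_m.+2,
    len (v * w)%g = (len v + len w)%N -> T v * T w = T (v * w)%g;
  T_quad : forall s : 'I_m.+1,
    (T (simple s) - u%:A) * (T (simple s) + uV%:A) = 0
}.
Arguments T {m H} w : rename.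
Arguments hcoord {m H} h : rename.
Arguments hcoordK {m H} h : rename.
Arguments hcoordE {m} H c : rename.
Arguments T_mul {m} H v w _ : rename.
Arguments T_quad {m} H s : rename.

Section Hecke.
Variables (m : nat) (H : heckeAlgebra m).
Local Notation W := 'S_m.+2.
Local Notation S := 'I_m.+1.
Implicit Types (v w : W) (s : S) (K : {set S}) (h : H).

(* C'_s = T_s + u^-1 *)
Definition Cs s : H := T (simple s) + uV%:A.

(* the subalgebra H_K, spanned by the T_w with w in W_K *)
Definition in_parabolic K h : Prop :=
  exists c : W -> A, h = \sum_(w in parabolic K) c w *: T w.

(* the semilinear involution with bar T_w = T_(w^-1)^-1 *)
Definition hbar h : H := \sum_w lbar (hcoord h w) *: (T w^-1%g)^-1.

Lemma hcoordP a h h' :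
  hcoord (a *: h + h') = [ffun w => a * hcoord h w + hcoord h' w].
Proof.
rewrite -{1}[h]hcoordK -{1}[h']hcoordK scaler_sumr -big_split /=.
rewrite -[RHS](hcoordE H); congr hcoord; apply: eq_bigr => w _.
by rewrite ffunE scalerDl scalerA.
Qed.

Lemma hbarP a h h' : hbar (a *: h + h') = lbar a *: hbar h + hbar h'.
Proof.
rewrite /hbar scaler_sumr -big_split /=; apply: eq_bigr => w _.
by rewrite hcoordP ffunE rmorphD rmorphM scalerDl scalerA.
Qed.

Lemma hbar0 : hbar 0 = 0.
Proof.
have /eqP := hbarP 1 0 0; rewrite rmorph1 !scale1r addr0 -{1}[hbar 0]addr0.
by rewrite (inj_eq (addrI _)) eq_sym => /eqP.
Qed.

Lemma hbarD h h' : hbar (h + h') = hbar h + hbar h'.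
Proof. by have := hbarP 1 h h'; rewrite rmorph1 !scale1r. Qed.

Lemma hbarZ a h : hbar (a *: h) = lbar a *: hbar h.
Proof. by have := hbarP a h 0; rewrite hbar0 !addr0. Qed.

Lemma hcoordT w : hcoord (T w : H) = [ffun v => (v == w)%:R].
Proof.
rewrite -[RHS](hcoordE H); congr hcoord.
rewrite (bigD1 w) //= ffunE eqxx scale1r big1 ?addr0 // => v /negbTE vw.
by rewrite ffunE vw scale0r.
Qed.

Lemma hbarT w : hbar (T w) = (T w^-1%g)^-1.
Proof.
rewrite /hbar hcoordT (bigD1 w) //= ffunE eqxx rmorph1 scale1r.
by rewrite big1 ?addr0 // => v /negbTE vw; rewrite ffunE vw rmorph0 scale0r.
Qed.

Lemma T1 : T 1%g = 1 :> H.
Proof.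
have T1h h : T 1%g * h = h.
  rewrite -[h]hcoordK mulr_sumr; apply: eq_bigr => w _.
  by rewrite -scalerAr T_mul ?mul1g ?len1.
by rewrite -[LHS]mulr1 T1h.
Qed.

Lemma upow_alg i j : (upow i)%:A * (upow j)%:A = (upow (i + j))%:A :> H.
Proof. by rewrite -scalerAl mul1r scalerA upowD. Qed.

Lemma T_simple_sqr s :
  T (simple s) * T (simple s) = (u - uV) *: T (simple s) + 1 :> H.
Proof.
have := T_quad H s; set t := T _.
rewrite mulrBl !mulrDr upow_alg addrN upow0 scale1r.
rewrite -!scalerAr mulr1 -!scalerAl mul1r opprD addrA => /eqP.
rewrite subr_eq0 => /eqP <-; rewrite scalerBl -(addrA (t * t)).
by rewrite -[X in _ = _ + (_ + X)]opprB addrC subrK.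
Qed.

Lemma T_simple_inv s : T (simple s) * (T (simple s) - (u - uV)%:A) = 1 :> H.
Proof. by rewrite mulrBr T_simple_sqr -scalerAr mulr1 addrC addKr. Qed.

Lemma T_simple_inv' s : (T (simple s) - (u - uV)%:A) * T (simple s) = 1 :> H.
Proof. by rewrite mulrBl T_simple_sqr -scalerAl mul1r addrC addKr. Qed.

Lemma T_simple_unit s : (T (simple s) : H) \is a GRing.unit.
Proof.
apply/unitrP; exists (T (simple s) - (u - uV)%:A).
by split; [exact: T_simple_inv'|exact: T_simple_inv].
Qed.

Lemma T_simpleV s : (T (simple s))^-1 = T (simple s) - (u - uV)%:A :> H.
Proof. by rewrite -[RHS](mulKr (T_simple_unit s)) T_simple_inv mulr1. Qed.

Lemma T_up s w : len (simple s * w)%g = (len w).+1 ->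
  T (simple s) * T w = T (simple s * w)%g :> H.
Proof. by move=> lw; rewrite T_mul // len_simple1 lw. Qed.

Lemma T_down s w : len w = (len (simple s * w)%g).+1 ->
  T (simple s) * T w = (u - uV) *: T w + T (simple s * w)%g :> H.
Proof.
move=> lw; have wE : T w = T (simple s) * T (simple s * w)%g :> H.
  by rewrite T_up simpleK.
by rewrite wE mulrA T_simple_sqr mulrDl mul1r -scalerAl -wE.
Qed.

Lemma T_unit w : (T w : H) \is a GRing.unit.
Proof.
elim: {w}(len w) {-2}w (erefl (len w)) => [|k IHk] w lw.
  have [->|/len_descent[s]] := eqVneq w 1%g; first by rewrite T1 unitr1.
  by rewrite lw.
have [w1|/len_descent[s sw]] := eqVneq w 1%g; first by rewrite w1 len1 in lw.
rewrite -(simpleK s w) -T_up ?simpleK //; rewrite unitrMl ?T_simple_unit //.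
by apply: IHk; apply/eqP; rewrite -eqSS -sw lw.
Qed.

(* (T_(w^-1))^-1 *)
Let Ti w : H := (T w^-1%g)^-1.

Let Ti_up s w : len (simple s * w)%g = (len w).+1 ->
  Ti (simple s * w)%g = (T (simple s))^-1 * Ti w.
Proof.
move=> lw; rewrite /Ti invMg simpleV -T_mul ?invrM ?T_unit //.
by rewrite -{1}(simpleV s) -invMg !lenV lw len_simple1 addn1.
Qed.

Lemma hbar_simpleM s h : hbar (T (simple s) * h) = (T (simple s))^-1 * hbar h.
Proof.
have hbar_sum (F : W -> H) : hbar (\sum_w F w) = \sum_w hbar (F w).
  exact: (big_morph _ hbarD hbar0).
rewrite -[h]hcoordK mulr_sumr !hbar_sum mulr_sumr; apply: eq_bigr => w _.
rewrite -scalerAr !hbarZ -scalerAr; congr (_ *: _).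
rewrite hbarT -/(Ti w); have [lw|lw] := len_simple s w.
  by rewrite T_up // hbarT -/(Ti _) Ti_up.
rewrite T_down // hbarP !hbarT -!/(Ti _).
have -> : Ti w = (T (simple s))^-1 * Ti (simple s * w)%g.
  by rewrite -Ti_up simpleK.
set x := Ti _; rewrite rmorphB /= !lbar_upow opprK mulrA scalerAl.
rewrite -{2}[x]mul1r -mulrDl; congr (_ * _).
rewrite [X in _ = _ * X]T_simpleV mulrBr mulVr ?T_simple_unit // -scalerAr mulr1.
by rewrite addrC -scaleNr opprB.
Qed.

Lemma hbarTM w h : hbar (T w * h) = hbar (T w) * hbar h.
Proof.
elim: {w}(len w) {-2}w (erefl (len w)) h => [|k IHk] w lw h.
  have [->|/len_descent[s]] := eqVneq w 1%g; last by rewrite lw.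
  by rewrite T1 mul1r -T1 hbarT invg1 T1 invr1 mul1r.
have [w1|/len_descent[s sw]] := eqVneq w 1%g; first by rewrite w1 len1 in lw.
rewrite -(simpleK s w) -T_up ?simpleK // -mulrA !hbar_simpleM -mulrA -IHk //.
by apply/eqP; rewrite -eqSS -sw lw.
Qed.

Lemma hbarM h h' : hbar (h * h') = hbar h * hbar h'.
Proof.
have hbar_sum (F : W -> H) : hbar (\sum_w F w) = \sum_w hbar (F w).
  exact: (big_morph _ hbarD hbar0).
rewrite -[h]hcoordK mulr_suml !hbar_sum mulr_suml; apply: eq_bigr => w _.
by rewrite -scalerAl !hbarZ -scalerAl hbarTM.
Qed.

Lemma hbar1 : hbar 1 = 1.
Proof. by rewrite -T1 hbarT invg1 T1 invr1. Qed.

Lemma hbar_Cs s : hbar (Cs s) = Cs s.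
Proof.
rewrite /Cs hbarD hbarT simpleV T_simpleV hbarZ hbar1 lbar_upow opprK.
by rewrite scalerBl opprB -addrA subrK.
Qed.

End Hecke.

(* ------------------------------------------------------------------------ *)
(* W-graphs.  A Gamma is the free A-module {malg A[Gamma]}, in which    *)
(* gamma is << gamma >>.  The sum of mu(delta, gamma) delta over the delta    *)
(* with s \in L(delta) is given by its coefficients; that it is an element of *)
(* A Gamma (i.e., finite) is part of the requirement.                         *)

Structure wgraph (m : nat) (H : heckeAlgebra m) := WGraph {
  vertex :> choiceType;
  mu : vertex -> vertex -> int;
  desc : vertex -> {set 'I_m.+1};
  act : H -> {malg A[vertex]} -> {malg A[vertex]};
  actDl : forall h h' x, act (h + h') x = act h x + act h' x;
  actDr : forall h x y, act h (x + y) = act h x + act h y;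
  actZl : forall a h x, act (a *: h) x = a *: act h x;
  actZr : forall a h x, act h (a *: x) = a *: act h x;
  act1 : forall x, act 1 x = x;
  actM : forall h h' x, act (h * h') x = act h (act h' x);
  act_desc : forall s gamma, s \in desc gamma ->
    act (Cs H s) << gamma >> = qtwo *: << gamma >>;
  act_ndesc : forall s gamma, s \notin desc gamma -> forall delta,
    (act (Cs H s) << gamma >>)@_delta =
      if s \in desc delta then (mu delta gamma)%:~R else 0
}.
Arguments mu {m H w} delta gamma : rename.
Arguments desc {m H w} gamma : rename.
Arguments act {m H w} h x : rename.

Section WGraphBar.
Variables (m : nat) (H : heckeAlgebra m) (G : wgraph H).
Local Notation AG := {malg A[G]}.

(* the semilinear involution of A Gamma fixing Gamma *)
Definition gbar (x : AG) : AG := semi_ext lbar (fun gamma : G => << gamma >>) x.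

Lemma gbarE (x : AG) gamma : (gbar x)@_gamma = lbar x@_gamma.
Proof.
rewrite [in RHS](monalgE x) /gbar /semi_ext !raddf_sum /=.
apply: eq_bigr => k _; rewrite mcoeffZ !mcoeffU raddfMn /=.
by rewrite -mulr_natr mulrnAr mulr1 mulr_natr.
Qed.

Lemma act_sum h (I : Type) (r : seq I) (F : I -> AG) :
  act h (\sum_(i <- r) F i) = \sum_(i <- r) act h (F i).
Proof.
apply: (big_morph _ (actDr h)); apply: (addrI (act h 0)).
by rewrite -actDr !addr0.
Qed.

Lemma gbarD : {morph gbar : x y / x + y}. Proof. exact: semi_extD. Qed.
Lemma gbarZ a x : gbar (a *: x) = lbar a *: gbar x.
Proof. exact: semi_extZ. Qed.

Lemma gbar_sum (I : Type) (r : seq I) (F : I -> AG) :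
  gbar (\sum_(i <- r) F i) = \sum_(i <- r) gbar (F i).
Proof. exact: (big_morph _ gbarD (semi_ext0 _ _)). Qed.

Lemma malg_span (x : AG) : x = \sum_(k <- msupp x) x@_k *: << k >>.
Proof.
rewrite {1}[x]monalgE; apply: eq_bigr => k _.
by apply/malgP => j; rewrite mcoeffZ !mcoeffU mulrnAr mulr1.
Qed.

Lemma gbar_actCs s (x : AG) : gbar (act (Cs H s) x) = act (Cs H s) (gbar x).
Proof.
have basis gamma : gbar (act (Cs H s) << gamma >>) = act (Cs H s) << gamma >>.
  apply/malgP => delta; rewrite gbarE.
  have [sg|sg] := boolP (s \in desc gamma).
    rewrite act_desc // mcoeffZ rmorphM /= lbar_qtwo; congr (_ * _).
    by rewrite mcoeffU rmorphMn rmorph1.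
  by rewrite act_ndesc //; case: ifP => _; rewrite ?rmorph_int ?rmorph0.
transitivity (\sum_(k <- msupp x) lbar x@_k *: act (Cs H s) << k >>).
  rewrite {1}[x]malg_span act_sum gbar_sum; apply: eq_bigr => k _.
  by rewrite actZr gbarZ basis.
by rewrite /gbar /semi_ext act_sum; apply: eq_bigr => k _; rewrite actZr.
Qed.

Lemma gbar_act h (x : AG) : gbar (act h x) = act (hbar h) (gbar x).
Proof.
have simple_case s y : gbar (act (T (simple s)) y)
    = act (hbar (T (simple s))) (gbar y).
  have -> : T (simple s) = Cs H s + (- uV)%:A.
    by rewrite /Cs scaleNr addrK.
  rewrite hbarD actDl gbarD gbar_actCs hbar_Cs actDl; congr (_ + _).
  by rewrite hbarZ hbar1 !actZl !act1 gbarZ.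
have T_case w y : gbar (act (T w) y) = act (hbar (T w)) (gbar y).
  elim: {w}(len w) {-2}w (erefl (len w)) y => [|k IHk] w lw y.
    have [->|/len_descent[s]] := eqVneq w 1%g; last by rewrite lw.
    by rewrite T1 hbar1 !act1.
  have [w1|/len_descent[s sw]] := eqVneq w 1%g; first by rewrite w1 len1 in lw.
  rewrite -(simpleK s w) -T_up ?simpleK // hbarM !actM simple_case IHk //.
  by apply/eqP; rewrite -eqSS -sw lw.
have act0l y : act (0 : H) y = 0.
  by apply: (addrI (act 0 y)); rewrite -actDl !addr0.
have suml (F : 'S_m.+2 -> H) y : act (\sum_w F w) y = \sum_w act (F w) y.
  by apply: (big_morph (fun h => act h y)) => [h1 h2|]; [exact: actDl | exact: act0l].
rewrite -[h]hcoordK suml gbar_sum (big_morph _ (@hbarD m H) (@hbar0 m H)) suml.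
by apply: eq_bigr => w _; rewrite actZl gbarZ hbarZ actZl T_case.
Qed.

End WGraphBar.

(* ------------------------------------------------------------------------ *)
(* x is a linear combination of vectors satisfying P with coefficients in C   *)

Definition lin_comb (M : lmodType A) (C : A -> Prop)
    (P : M -> Prop) (x : M) : Prop :=
  exists2 t : seq (A * M), (forall p, p \in t -> C p.1 /\ P p.2)
    & x = \sum_(p <- t) p.1 *: p.2.

(* ------------------------------------------------------------------------ *)
(* The tensor product of H and A Gamma over H_K: the quotient of the free     *)
(* A-module on the pairs (h, e) by the submodule spanned by the relations     *)
(* making (h, e) A-bilinear and H_K-balanced                                  *)

Section Tensor.
Variables (m : nat) (H : heckeAlgebra m) (G : wgraph H) (K : {set 'I_m.+1}).
Local Notation AG := {malg A[G]}.
Local Notation HE := (H * AG)%type.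
Local Notation FHE := {malg A[HE]}.

Inductive tens_rel : FHE -> Prop :=
| TensDl h h' (e : AG) :
    tens_rel (<< (h + h', e) >> - << (h, e) >> - << (h', e) >>)
| TensDr h (e e' : AG) :
    tens_rel (<< (h, e + e') >> - << (h, e) >> - << (h, e') >>)
| TensZl a h (e : AG) : tens_rel (<< (a *: h, e) >> - a *: << (h, e) >>)
| TensZr a h (e : AG) : tens_rel (<< (h, a *: e) >> - a *: << (h, e) >>)
| TensK h k (e : AG) : in_parabolic K k ->
    tens_rel (<< (h * k, e) >> - << (h, act k e) >>).

Definition tens_null : {pred FHE} :=
  fun x => `[< lin_comb (fun=> True) tens_rel x >].

Lemma tens_nullZ a x : x \in tens_null -> a *: x \in tens_null.
Proof.
move=> /asboolP[t tP ->]; apply/asboolP.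
exists [seq (a * p.1, p.2) | p <- t] => [_ /mapP[p /tP[_ rp] ->]|] //.
by rewrite scaler_sumr big_map; apply: eq_bigr => p _; rewrite scalerA.
Qed.

Lemma tens_null_closed : zmod_closed tens_null.
Proof.
split; first by apply/asboolP; exists [::]; rewrite ?big_nil.
move=> x y xP /(tens_nullZ (-1)); rewrite scaleN1r.
move: xP => /asboolP[t tP ->] /asboolP[t' tP' ->]; apply/asboolP.
exists (t ++ t'); last by rewrite big_cat.
by move=> p; rewrite mem_cat => /orP[/tP|/tP'].
Qed.

HB.instance Definition _ := GRing.isZmodClosed.Build _ tens_null tens_null_closed.

Definition tensor : Type := Quotient.quot tens_null.
HB.instance Definition _ := GRing.Zmodule.on tensor.

Definition tpi (x : FHE) : tensor := \pi_(Quotient.quot tens_null)%qT x.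

Lemma tpiD : {morph tpi : x y / x + y}.
Proof. by move=> x y; rewrite /tpi raddfD. Qed.

Lemma tpi_eq x y : (tpi x = tpi y) <-> (x - y \in tens_null).
Proof.
by rewrite Quotient.idealrBE; split=> [/eqP|/eqP]; rewrite // => ->.
Qed.

Definition tscale (a : A) (x : tensor) : tensor :=
  tpi (a *: generic_quotient.repr (x : Quotient.quot tens_null)).

Lemma tpiK (x : tensor) : tpi (generic_quotient.repr (x : Quotient.quot tens_null)) = x.
Proof. exact: reprK. Qed.

Lemma tscaleE a x : tscale a (tpi x) = tpi (a *: x).
Proof.
by apply/tpi_eq; rewrite -scalerBr; apply/tens_nullZ/tpi_eq; rewrite tpiK.
Qed.

Fact tscaleA a b x : tscale a (tscale b x) = tscale (a * b) x.
Proof. by rewrite -[x]tpiK !tscaleE scalerA. Qed.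

Fact tscale1 : left_id 1 tscale.
Proof. by move=> x; rewrite -[x]tpiK tscaleE scale1r. Qed.

Fact tscaleDr : right_distributive tscale +%R.
Proof.
by move=> a x y; rewrite -[x]tpiK -[y]tpiK -tpiD !tscaleE scalerDr tpiD.
Qed.

Fact tscaleDl x : {morph tscale^~ x : a b / a + b}.
Proof. by move=> a b; rewrite -[x]tpiK !tscaleE scalerDl tpiD. Qed.

HB.instance Definition _ := GRing.Zmodule_isLmodule.Build A tensor
  tscaleA tscale1 tscaleDr tscaleDl.

Definition pure (h : H) (e : AG) : tensor := tpi << (h, e) >>.

Lemma tpiZ a x : tpi (a *: x) = a *: tpi x.
Proof. exact: (esym (tscaleE a x)). Qed.

Lemma tpiB : {morph tpi : x y / x - y}.
Proof. by move=> x y; rewrite tpiD -[- y]scaleN1r tpiZ scaleN1r. Qed.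

Lemma tpi_rel x : tens_rel x -> tpi x = 0.
Proof.
move=> xP; have -> : 0 = tpi 0 by rewrite /tpi raddf0.
apply/tpi_eq; rewrite subr0; apply/asboolP; exists [:: (1, x)].
  by move=> p; rewrite inE => /eqP ->.
by rewrite big_seq1 scale1r.
Qed.

Lemma pureDl h h' e : pure (h + h') e = pure h e + pure h' e.
Proof.
by apply/eqP; rewrite -subr_eq0 opprD addrA -!tpiB tpi_rel //; apply: TensDl.
Qed.

Lemma pureDr h e e' : pure h (e + e') = pure h e + pure h e'.
Proof.
by apply/eqP; rewrite -subr_eq0 opprD addrA -!tpiB tpi_rel //; apply: TensDr.
Qed.

Lemma pureZl a h e : pure (a *: h) e = a *: pure h e.
Proof.
by apply/eqP; rewrite -subr_eq0 -tpiZ -tpiB tpi_rel //; apply: TensZl.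
Qed.

Lemma pureZr a h e : pure h (a *: e) = a *: pure h e.
Proof.
by apply/eqP; rewrite -subr_eq0 -tpiZ -tpiB tpi_rel //; apply: TensZr.
Qed.

Lemma pureK h k e : in_parabolic K k -> pure (h * k) e = pure h (act k e).
Proof.
by move=> kK; apply/eqP; rewrite -subr_eq0 -tpiB tpi_rel //; apply: TensK.
Qed.

Lemma pure_sum_balanced (c : 'S_m.+2 -> A) (F : 'S_m.+2 -> H) h e :
  (forall w, w \in parabolic K ->
     forall h' e', pure (h' * F w) e' = pure h' (act (F w) e')) ->
  pure (h * \sum_(w in parabolic K) c w *: F w) e =
  pure h (act (\sum_(w in parabolic K) c w *: F w) e).
Proof.
move=> FP; rewrite mulr_sumr.
rewrite (big_morph (fun h => pure h e) (fun h1 h2 => pureDl h1 h2 e) (id1 := 0));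
  last by apply: (addrI (pure 0 e)); rewrite -pureDl !addr0.
rewrite (big_morph (fun k => act k e) (fun h1 h2 => actDl h1 h2 e) (id1 := 0));
  last by apply: (addrI (act 0 e)); rewrite -actDl !addr0.
rewrite (big_morph (pure h) (pureDr h) (id1 := 0));
  last by apply: (addrI (pure h 0)); rewrite -pureDr !addr0.
apply: eq_bigr => w wK.
by rewrite -scalerAr pureZl actZl pureZr FP.
Qed.

Lemma pure_T_balanced w h e : w \in parabolic K ->
  pure (h * T w) e = pure h (act (T w) e).
Proof.
move=> wK; apply: pureK; exists (fun v => (v == w)%:R).
rewrite (bigD1 w) //= eqxx scale1r big1 ?addr0 // => v /andP[_ /negbTE ->].
by rewrite scale0r.
Qed.

Lemma pure_hbar_balanced h k e : in_parabolic K k ->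
  pure (h * hbar k) e = pure h (act (hbar k) e).
Proof.
case=> c ->; rewrite (big_morph _ (@hbarD m H) (@hbar0 m H)).
have -> : \sum_(w in parabolic K) hbar (c w *: T w) =
    \sum_(w in parabolic K) lbar (c w) *: (T w^-1%g)^-1 :> H.
  by apply: eq_bigr => w _; rewrite hbarZ hbarT.
apply: pure_sum_balanced => w wK h' e'.
have uT : (T w^-1%g : H) \is a GRing.unit by apply: T_unit.
rewrite -{1}[e']act1 -(divrr uT) actM -pure_T_balanced ?groupV //.
by rewrite divrK.
Qed.

(* a semilinear map on the tensor product, given on pure tensors by f *)
Definition tlift (N : lmodType A) (sigma : {rmorphism A -> A})
    (f : HE -> N) (x : tensor) : N :=
  semi_ext sigma f (generic_quotient.repr (x : Quotient.quot tens_null)).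

Section Lift.
Variables (N : lmodType A) (sigma : {rmorphism A -> A}).
Variable f : HE -> N.
Hypotheses
  (fDl : forall h h' e, f (h + h', e) = f (h, e) + f (h', e))
  (fDr : forall h e e', f (h, e + e') = f (h, e) + f (h, e'))
  (fZl : forall a h e, f (a *: h, e) = sigma a *: f (h, e))
  (fZr : forall a h e, f (h, a *: e) = sigma a *: f (h, e))
  (fK : forall h k e, in_parabolic K k -> f (h * k, e) = f (h, act k e)).

Let ext1 p : semi_ext sigma f << p >> = f p.
Proof. by rewrite semi_extU rmorph1 scale1r. Qed.

Let ext1B p q : semi_ext sigma f (<< p >> - << q >>) = f p - f q.
Proof. by rewrite -(ext1 p) -(ext1 q) -semi_extB. Qed.

Let ext1BZ p a q : semi_ext sigma f (<< p >> - a *: << q >>) = f p - sigma a *: f q.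
Proof. by rewrite -(ext1 p) -(ext1 q) -semi_extZ -semi_extB. Qed.

Let ext1BB p q r : semi_ext sigma f (<< p >> - << q >> - << r >>) = f p - f q - f r.
Proof. by rewrite -(ext1B p q) -(ext1 r) -semi_extB. Qed.

Lemma semi_ext_rel x : tens_rel x -> semi_ext sigma f x = 0.
Proof.
case=> [h h' e|h e e'|a h e|a h e|h k e kK].
- by rewrite ext1BB fDl addrAC addrK subrr.
- by rewrite ext1BB fDr addrAC addrK subrr.
- by rewrite ext1BZ fZl subrr.
- by rewrite ext1BZ fZr subrr.
- by rewrite ext1B (fK _ _ kK) subrr.
Qed.

Lemma tlift_tpi x : tlift sigma f (tpi x) = semi_ext sigma f x.
Proof.
apply/eqP; rewrite -subr_eq0 -semi_extB; apply/eqP.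
have /tpi_eq/asboolP[t tP ->] := tpiK (tpi x).
rewrite (big_morph _ (semi_extD sigma f) (semi_ext0 sigma f)) big_seq big1 // => p.
by case/tP => _ /semi_ext_rel p0; rewrite semi_extZ p0 scaler0.
Qed.

Lemma tliftD : {morph tlift sigma f : x y / x + y}.
Proof.
by move=> x y; rewrite -[x]tpiK -[y]tpiK -tpiD !tlift_tpi semi_extD.
Qed.

Lemma tliftZ a x : tlift sigma f (a *: x) = sigma a *: tlift sigma f x.
Proof. by rewrite -[x]tpiK -tpiZ !tlift_tpi semi_extZ. Qed.

Lemma tlift_pure h e : tlift sigma f (pure h e) = f (h, e).
Proof. by rewrite tlift_tpi ext1. Qed.

End Lift.

Definition tbar : tensor -> tensor :=
  tlift lbar (fun p => pure (hbar p.1) (gbar p.2)).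

Let tbarP :
  let f p := pure (hbar p.1) (gbar p.2) in
  [/\ forall h h' e, f (h + h', e) = f (h, e) + f (h', e),
      forall h e e', f (h, e + e') = f (h, e) + f (h, e'),
      forall a h e, f (a *: h, e) = lbar a *: f (h, e),
      forall a h e, f (h, a *: e) = lbar a *: f (h, e) &
      forall h k e, in_parabolic K k -> f (h * k, e) = f (h, act k e)].
Proof.
split=> /= [h h' e|h e e'|a h e|a h e|h k e kK].
- by rewrite hbarD pureDl.
- by rewrite gbarD pureDr.
- by rewrite hbarZ pureZl.
- by rewrite gbarZ pureZr.
- by rewrite hbarM gbar_act pure_hbar_balanced.
Qed.

Lemma tbarD : {morph tbar : x y / x + y}.
Proof.
case: tbarP => fDl fDr fZl fZr fK.
exact: (tliftD (sigma := lbar)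
  (f := (fun p : HE => pure (hbar p.1) (gbar p.2))) fDl fDr fZl fZr fK).
Qed.

Lemma tbarZ a x : tbar (a *: x) = lbar a *: tbar x.
Proof.
case: tbarP => fDl fDr fZl fZr fK.
exact: (tliftZ (sigma := lbar)
  (f := (fun p : HE => pure (hbar p.1) (gbar p.2))) fDl fDr fZl fZr fK).
Qed.

Lemma tbar_pure h e : tbar (pure h e) = pure (hbar h) (gbar e).
Proof.
case: tbarP => fDl fDr fZl fZr fK.
exact: (tlift_pure (sigma := lbar)
  (f := (fun p : HE => pure (hbar p.1) (gbar p.2))) fDl fDr fZl fZr fK).
Qed.

End Tensor.
Arguments pure {m H G K} h e.
Arguments tbar {m H G K} x.

(* For K \subset K', the map h (x) e |-> h (x) e (see tproj_pure)              *)

Section Projection.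
Variables (m : nat) (H : heckeAlgebra m) (G : wgraph H).
Variables (K K' : {set 'I_m.+1}).

Definition tproj : tensor G K -> tensor G K' :=
  tlift idfun (fun p => pure p.1 p.2).

Hypothesis KK' : K \subset K'.

Lemma in_parabolicS (k : H) : in_parabolic K k -> in_parabolic K' k.
Proof.
case=> c ->; exists (fun w => if w \in parabolic K then c w else 0).
have /subsetP WKK' : parabolic K \subset parabolic K'.
  by rewrite genS // imsetS.
rewrite [RHS](bigID (mem (parabolic K))) /= [X in _ = _ + X]big1 ?addr0.
  apply: eq_big => [w|w wK]; last by rewrite wK.
  by case wK: (w \in parabolic K); rewrite ?andbF // andbT WKK'.
by move=> w /andP[_ /negbTE ->]; rewrite scale0r.
Qed.

Let tprojP :
  let f (p : H * {malg A[G]}) : tensor G K' := pure p.1 p.2 in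
  [/\ forall h h' e, f (h + h', e) = f (h, e) + f (h', e),
      forall h e e', f (h, e + e') = f (h, e) + f (h, e'),
      forall a h e, f (a *: h, e) = a *: f (h, e),
      forall a h e, f (h, a *: e) = a *: f (h, e) &
      forall h k e, in_parabolic K k -> f (h * k, e) = f (h, act k e)].
Proof.
split=> /= [h h' e|h e e'|a h e|a h e|h k e kK].
- exact: pureDl.
- exact: pureDr.
- exact: pureZl.
- exact: pureZr.
- by apply: pureK; apply: in_parabolicS.
Qed.

Lemma tprojD : {morph tproj : x y / x + y}.
Proof.
case: tprojP => fDl fDr fZl fZr fK.
exact: (tliftD (sigma := idfun)
  (f := (fun p : H * {malg A[G]} => pure p.1 p.2 : tensor G K')) fDl fDr fZl fZr fK).
Qed.

Lemma tprojZ a x : tproj (a *: x) = a *: tproj x.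
Proof.
case: tprojP => fDl fDr fZl fZr fK.
exact: (tliftZ (sigma := idfun)
  (f := (fun p : H * {malg A[G]} => pure p.1 p.2 : tensor G K')) fDl fDr fZl fZr fK).
Qed.

Lemma tproj_pure h e : tproj (pure h e) = pure h e.
Proof.
case: tprojP => fDl fDr fZl fZr fK.
exact: (tlift_pure (sigma := idfun)
  (f := (fun p : H * {malg A[G]} => pure p.1 p.2 : tensor G K')) fDl fDr fZl fZr fK).
Qed.

End Projection.
Arguments tproj {m H G} K K' x.

(* ------------------------------------------------------------------------ *)
(* C is the canonical (Howlett-Yin) basis of the tensor product over H_K;     *)
(* only the values C w gamma with w in W^K matter.                            *)

Definition canonical_basis (m : nat) (H : heckeAlgebra m) (G : wgraph H)
    (K : {set 'I_m.+1}) (C : 'S_m.+2 -> G -> tensor G K) : Prop :=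
  [/\ forall x : tensor G K, exists! c : {malg A[('S_m.+2 * G)%type]},
        (forall p, p \in msupp c -> p.1 \in minreps K) /\
        x = \sum_(p <- msupp c) c@_p *: C p.1 p.2,
      forall w gamma, w \in minreps K -> tbar (C w gamma) = C w gamma
    & forall w gamma, w \in minreps K ->
        lin_comb uVAminus
          (fun y => exists x delta, x \in minreps K /\ y = pure (T x) << delta >>)
          (C w gamma - pure (T w) << gamma >>)].

(* J'_(n-2) = {s_3, ..., s_(n-1)} and S \ s_2; recall that i : 'I_m.+1 is    *)
(* s_(i+1).  For m = 0, i.e., n = 2, they are the empty set and {s_1}.        *)
Definition Jprime (m : nat) : {set 'I_m.+1} := [set i : 'I_m.+1 | 2 <= i]%N.
Definition Sminus2 (m : nat) : {set 'I_m.+1} := [set i : 'I_m.+1 | i != 1 :> nat]%N.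

Lemma Jprime_sub (m : nat) : Jprime m \subset Sminus2 m.
Proof. by apply/subsetP => i; rewrite !inE; lia. Qed.

(* L^*, for the canonical basis C of the tensor product over S \ s_2          *)
Definition Lstar (m : nat) (H : heckeAlgebra m) (G : wgraph H)
    (C : 'S_m.+2 -> G -> tensor G (Sminus2 m)) : tensor G (Sminus2 m) -> Prop :=
  lin_comb Aminus (fun y => exists w gamma,
    [/\ w \in minreps (Sminus2 m), ord0 \in desc gamma & y = C w gamma]).

(* Main.v *)
Require Import Defs.
From HB Require Import structures.
From mathcomp Require Import all_boot all_order all_algebra all_fingroup.
From mathcomp Require Import finmap zify ring.
From mathcomp.multinomials Require Import monalg.

Set Implicit Arguments.
Unset Strict Implicit.
Unset Printing Implicit Defensive.

Import GRing.Theory.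
Local Open Scope ring_scope.

(* Everything is read off from coordinates in the free modules spanned by the
   T_w (x) gamma.  Bar is unitriangular for the length, so a bar-invariant
   element all of whose coordinates lie in u^-1 A^- vanishes; the same holds
   modulo an H_K-stable span of vertices, and the span of the gamma with
   s_1 in L(gamma) is H_(S\s_2)-stable because C'_(s_1) is central there.
   The images under beta are bar-invariant, with coordinates in u^-1 A^- at the
   gamma with s_1 not in L(gamma) and in A^- at the others (after subtracting
   C'_(w,gamma) in the last case), hence they lie in L^*.  The first formula is
   exact since h (x) e |-> h C'_(s_1) (x) e + h (x) C'_(s_1) e - [2] h (x) e
   maps C'_(w,gamma) back to C'_(w s_1,gamma). *)

(** * Coefficients of Laurent polynomials *)

Section Coefficients.
Implicit Types f g : A.

Lemma coefuD k f g : coefu k (f + g) = coefu k f + coefu k g.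
Proof. exact: mcoeffD. Qed.

Lemma coefuN k f : coefu k (- f) = - coefu k f.
Proof. exact: mcoeffN. Qed.

Lemma coefu0 k : coefu k 0 = 0.
Proof. exact: mcoeff0. Qed.

Lemma coefu_upow i k : coefu k (upow i) = (i == k)%:R.
Proof. by rewrite /coefu /= mcoeffU. Qed.

Lemma coefu_upowM i k f : coefu k (upow i * f) = coefu (k - i) f.
Proof.
rewrite /coefu /= (laurent_mulw msuppU_le (fsubset_refl _)) big_seq_fset1.
rewrite [in RHS](monalgE (lcoef f)) !raddf_sum; apply: eq_bigr => j _ /=.
rewrite mcoeffUU mul1r !mcoeffU; congr (_ *+ (nat_of_bool _)).
by rewrite [in RHS]eq_sym subr_eq addrC eq_sym.
Qed.

Lemma uVAminusP f : uVAminus f <-> forall k : int, 0 <= k -> coefu k f = 0.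
Proof.
split=> [[g gP ->] k k0|fP].
  by rewrite coefu_upowM gP //; lia.
exists (upow 1 * f); last by rewrite mulrA -upowD upow0 mul1r.
by move=> k k0; rewrite coefu_upowM fP //; lia.
Qed.

Lemma uVAminusW f : uVAminus f -> Aminus f.
Proof. by move/uVAminusP => fP k k0; apply: fP; lia. Qed.

Lemma Aminus0 : Aminus 0. Proof. by move=> k _; rewrite coefu0. Qed.
Lemma uVAminus0 : uVAminus 0. Proof. by apply/uVAminusP => k _; rewrite coefu0. Qed.

Lemma AminusD f g : Aminus f -> Aminus g -> Aminus (f + g).
Proof. by move=> fP gP k k0; rewrite coefuD fP // gP. Qed.

Lemma uVAminusD f g : uVAminus f -> uVAminus g -> uVAminus (f + g).
Proof.
move=> /uVAminusP fP /uVAminusP gP; apply/uVAminusP => k k0.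
by rewrite coefuD fP // gP.
Qed.

Lemma AminusN f : Aminus f -> Aminus (- f).
Proof. by move=> fP k k0; rewrite coefuN fP. Qed.

Lemma uVAminusN f : uVAminus f -> uVAminus (- f).
Proof. by move=> /uVAminusP fP; apply/uVAminusP => k k0; rewrite coefuN fP. Qed.

Lemma Aminus_int (z : int) : Aminus z%:~R.
Proof.
have nat_case (n : nat) : Aminus n%:R.
  elim: n => [|n IHn]; first exact: Aminus0.
  rewrite -natr1; apply: AminusD IHn _ => k k0.
  by rewrite -upow0 coefu_upow; case: eqP => // kE; lia.
by case: z => n; [exact: nat_case|rewrite NegzE mulrNz; apply/AminusN/nat_case].
Qed.

Lemma uVAminus_uV f : Aminus f -> uVAminus (upow (-1) * f).
Proof. by exists f. Qed.

Lemma uVAminusMint f (z : int) : uVAminus f -> uVAminus (f * z%:~R).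
Proof.
move=> fP; have n_case (n : nat) : uVAminus (f * n%:R).
  elim: n => [|n IHn]; first by rewrite mulr0; exact: uVAminus0.
  by rewrite -natr1 mulrDr mulr1; exact: uVAminusD.
case: z => n; first exact: n_case.
by rewrite NegzE mulrNz mulrN; apply/uVAminusN/n_case.
Qed.

Lemma Aminus_u f : uVAminus f -> Aminus (f * upow 1).
Proof. by move/uVAminusP => fP k k0; rewrite mulrC coefu_upowM fP //; lia. Qed.

Lemma uVAminusMuV f : uVAminus f -> uVAminus (f * upow (-1)).
Proof. by move/uVAminusW/uVAminus_uV; rewrite mulrC. Qed.

(** Bar reverses degrees, so vanishing in degrees at least 0 carries over to degrees at most 0. *)
Lemma uVAminus_lbar f : uVAminus f -> lbar f = f -> f = 0.
Proof.
move=> /uVAminusP fP fV; apply/coefuP => k; rewrite coefu0.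
have [k0|k0] : 0 <= k \/ 0 <= - k by lia.
  exact: fP.
by rewrite -fV lbarE fP.
Qed.

(** If [2] f = 0, the coefficients of f repeat with step 2 up to sign, and finite support forces
    them to vanish. *)
Lemma qtwo_reg f : qtwo * f = 0 -> f = 0.
Proof.
move=> f0; have step k : coefu k f = - coefu (k - 2) f.
  have := coefu_upowM 1 (k - 1) f; have := coefu_upowM (-1) (k - 1) f.
  have : coefu (k - 1) (qtwo * f) = 0 by rewrite f0 coefu0.
  rewrite /qtwo mulrDl coefuD => /eqP; rewrite addr_eq0 => /eqP e e1 e2.
  rewrite (_ : k - 2 = k - 1 - 1); last by lia.
  by rewrite -e2 e e1 opprK; congr (coefu _ _); lia.
have far k (j : nat) : coefu k f = (-1) ^+ j * coefu (k - 2 * j%:Z) f.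
  elim: j => [|j IHj]; first by rewrite mul1r mulr0 subr0.
  rewrite (_ : k - 2 * j.+1%:Z = k - 2 * j%:Z - 2); last by rewrite intS; ring.
  by rewrite IHj step exprS mulN1r mulrN mulNr.
apply/coefuP => k; rewrite coefu0.
have [N NP] : exists N : nat, forall i, i \in msupp (lcoef f) -> (`|i| <= N)%N.
  exists (\sum_(i <- msupp (lcoef f)) `|i|)%N => i iP.
  by rewrite (big_rem i) //= leq_addr.
(* Shifting k down by 2 (N + |k| + 1) leads outside the support, whose degrees are at most N in
   absolute value. *)
rewrite (far k (N + `|k|.+1)%N) /coefu mcoeff_outdom ?mulr0 //.
by apply/negP => /NP; lia.
Qed.

Lemma u_neq_uV : upow 1 - upow (-1) != 0 :> A.
Proof.
apply/eqP => /(congr1 (coefu 1)).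
by rewrite coefuD coefuN !coefu_upow coefu0.
Qed.

(** Constant terms are integers, hence bar-invariant; they will serve as coefficients of canonical
    basis elements. *)
Lemma int_part f : Aminus f -> uVAminus (f - (coefu 0 f)%:~R).
Proof.
move=> fP; apply/uVAminusP => k k0; rewrite coefuD coefuN.
have cint (z : int) : coefu k (z%:~R : A) = if k == 0 then z else 0.
  have nc (n : nat) : coefu k (n%:R : A) = if k == 0 then n%:Z else 0.
    elim: n => [|n IHn]; first by rewrite coefu0 if_same.
    rewrite -natr1 coefuD IHn -upow0 coefu_upow [0 == k]eq_sym.
    by case: (k == 0); rewrite /= ?mulr0n ?mulr1n ?addr0 // [RHS]intS addrC.
  case: z => n; first exact: nc.
  by rewrite NegzE mulrNz coefuN nc; case: ifP => // _; rewrite oppr0.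
rewrite cint; have [->|k1] := eqVneq k 0; first by rewrite subrr.
by rewrite subr0 fP //; lia.
Qed.

End Coefficients.

(** * The exchange property and minimal coset representatives *)

Section Exchange.
Variables (m : nat) (H : heckeAlgebra m).
Local Notation W := 'S_m.+2.
Local Notation S := 'I_m.+1.
Implicit Types (v w k : W) (s t : S) (K : {set S}).

Lemma hcoordD (h h' : H) w : hcoord (h + h') w = hcoord h w + hcoord h' w.
Proof. by have := hcoordP 1 h h'; rewrite scale1r => ->; rewrite ffunE mul1r. Qed.

Lemma hcoord0 w : hcoord (0 : H) w = 0.
Proof. by apply: (addrI (hcoord (0 : H) w)); rewrite -hcoordD !addr0. Qed.

Lemma hcoordZ a (h : H) w : hcoord (a *: h) w = a * hcoord h w.
Proof. by have := hcoordP a h 0; rewrite addr0 => ->; rewrite ffunE hcoord0 addr0. Qed.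

Lemma hcoord_sum (I : Type) (r : seq I) (P : pred I) (F : I -> H) w :
  hcoord (\sum_(i <- r | P i) F i) w = \sum_(i <- r | P i) hcoord (F i) w.
Proof.
exact: (big_morph (fun h => hcoord h w) (fun h h' => hcoordD h h' w) (hcoord0 w)).
Qed.

Lemma len_simpler w s :
  len (w * simple s)%g = (len w).+1 \/ len w = (len (w * simple s)%g).+1.
Proof.
rewrite -(lenV (w * _)%g) -(lenV w) invMg simpleV; exact: len_simple.
Qed.

Lemma simpleKr w s : (w * simple s * simple s)%g = w.
Proof. by rewrite -mulgA simple2 mulg1. Qed.

Lemma T_upr w s : len (w * simple s)%g = (len w).+1 ->
  T w * T (simple s) = T (w * simple s)%g :> H.
Proof. by move=> lw; rewrite T_mul // len_simple1 addn1. Qed.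

Lemma T_downr w s : len w = (len (w * simple s)%g).+1 ->
  T w * T (simple s) = (upow 1 - upow (-1)) *: T w + T (w * simple s)%g :> H.
Proof.
move=> lw; have wE : T w = T (w * simple s)%g * T (simple s) :> H.
  by rewrite T_upr simpleKr.
by rewrite {1}wE -mulrA T_simple_sqr mulrDr mulr1 -scalerAr -wE.
Qed.

(* T_s T_w T_t, computed as (T_s T_w) T_t and as T_s (T_w T_t). *)
Lemma exchange s w t :
    len (simple s * w)%g = (len w).+1 -> len (w * simple t)%g = (len w).+1 ->
    len (simple s * w * simple t)%g = len w ->
  (simple s * w = w * simple t)%g.
Proof.
move=> ls lt lst.
have : T (simple s) * T w * T (simple t) = T (simple s) * (T w * T (simple t)) :> H.
  by rewrite mulrA.
rewrite (T_up _ ls) (T_upr lt) T_downr ?ls ?lst // T_down ?lt ?mulgA ?lst //.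
(* The common term $T_{swt}$ cancels; since $u\ne u^{-1}$, comparing coefficients at $sw$ forces
   $sw=wt$. *)
move/addIr/(congr1 (fun h => hcoord h (simple s * w)%g)).
rewrite !hcoordZ !hcoordT !ffunE eqxx mulr1; case: eqP => // _.
by rewrite mulr0 => e; have := u_neq_uV; rewrite e eqxx.
Qed.

Lemma parabolic_simple K t : t \in K -> simple t \in parabolic K.
Proof. by move=> tK; apply/mem_gen/imset_f. Qed.

Lemma parabolic_ind K (P : W -> Prop) :
    P 1%g ->
    (forall k t, k \in parabolic K -> t \in K -> P k -> P (k * simple t)%g) ->
  forall k, k \in parabolic K -> P k.
Proof.
move=> P1 PM k /gen_prodgP[n [c cK ->]] {k}.
suff [] : (\prod_(i < n) c i)%g \in parabolic K /\ P (\prod_(i < n) c i)%g by [].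
elim: n c cK => [|n IHn] c cK; first by rewrite big_ord0 group1.
rewrite big_ord_recr /=.
have [|cP cQ] := IHn (fun i => c (widen_ord (leqnSn n) i)); first by move=> i.
have /imsetP[t tK ->] := cK ord_max.
by split; [rewrite groupM ?parabolic_simple|apply: PM].
Qed.

Lemma minrepsP K w :
  reflect (forall k, k \in parabolic K -> (len w <= len (w * k)%g)%N) (w \in minreps K).
Proof. by rewrite inE; exact: forall_inP. Qed.

Lemma len_eq0 w : (len w == 0%N) = (w == 1%g).
Proof.
apply/eqP/eqP => [w0|->]; last exact: len1.
by apply/eqP/negP => /negP/len_descent[s]; rewrite w0.
Qed.

(** Induction on w = s v, where v is again minimal. If s shortened some v x t with x in W_K and t in
    K, exchange would give s v x = v x t, so w would share its coset with the shorter v. *)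
Lemma len_minreps K w k : w \in minreps K -> k \in parabolic K ->
  len (w * k)%g = (len w + len k)%N.
Proof.
elim: {w}(len w) {-2}w (erefl (len w)) k => [|n IHn] w lw k wK.
  by move/eqP: lw; rewrite len_eq0 => /eqP->; rewrite mul1g len1.
have [w1|/len_descent[s sw]] := eqVneq w 1%g; first by rewrite w1 len1 in lw.
pose v : W := (simple s * w)%g; have wE : w = (simple s * v)%g by rewrite simpleK.
have lv : len v = n by rewrite /v; lia.
(* For x in W_K, $\ell(v)+1=\ell(w)\le\ell(wx)\le\ell(vx)+1$. *)
have vK : v \in minreps K.
  apply/minrepsP => x /(minrepsP _ _ wK).
  have := len_simple_le s (v * x)%g; rewrite mulgA -wE => l1 l2.
  by have := leq_trans l2 l1; rewrite lw lv.
clearbody v => {sw}; have IHv x : x \in parabolic K -> len (v * x)%g = (n + len x)%N.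
  by move=> xK; rewrite (IHn v) // lv.
suff up x : x \in parabolic K -> len (simple s * (v * x))%g = (len (v * x)%g).+1.
  by move=> kK; rewrite wE -mulgA up // IHv // -wE lw.
move: x; apply: parabolic_ind => [|x t xK tK IHx].
  by rewrite mulg1 -wE lw lv.
have tP := parabolic_simple tK.
have [//|down] := len_simple s (v * (x * simple t))%g.
have lvx := IHv x xK; have lvxt := IHv _ (groupM xK tP).
have leS y r : (len (y : W) <= (len (y * simple r)%g).+1)%N.
  by case: (len_simpler y r); lia.
rewrite lvxt in down; case: (len_simpler x t) => lxt; last first.
  (* If t shortens x, then $svxt$ would be shorter than $svx$ by 3, which one reflection cannot
     achieve. *)
  have := leS (simple s * (v * x))%g t.
  by rewrite IHx -!mulgA -down lvx lxt ltn_add2l ltnNge leqnSn.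
have e : (simple s * (v * x) = v * x * simple t)%g.
  apply: exchange => //; first by rewrite -mulgA lvxt lvx lxt addnS.
  by apply: succn_inj; rewrite -!mulgA -down lvx lxt addnS.
(* Now w lies in v W_K, yet v is shorter than w. *)
have e' : w = (v * (x * simple t * x^-1))%g.
  by apply: (mulIg x); rewrite {1}wE -mulgA e -!mulgA mulVg mulg1.
have rK : (x * simple t * x^-1)%g \in parabolic K by rewrite !groupM ?groupV.
have := minrepsP _ _ wK (x * simple t * x^-1)^-1%g; rewrite groupV => /(_ rK).
by rewrite {2}e' mulgK lw lv ltnn.
Qed.

Lemma minreps_decomp K v :
  exists w k, [/\ w \in minreps K, k \in parabolic K & v = (w * k)%g].
Proof.
case: (@arg_minnP _ 1%g (mem (parabolic K)) (fun k => len (v * k)%g) (group1 _)).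
move=> k kK kmin.
exists (v * k)%g, k^-1%g; split; rewrite ?groupV ?mulgK //.
by apply/minrepsP => x xK; rewrite -mulgA; apply: kmin; exact: groupM.
Qed.

Lemma minreps_uniq K w w' k k' : w \in minreps K -> w' \in minreps K ->
    k \in parabolic K -> k' \in parabolic K -> (w * k = w' * k')%g ->
  w = w' /\ k = k'.
Proof.
move=> wK wK' kK kK' e; have [r [rK wE]] : exists r, r \in parabolic K /\ w' = (w * r)%g.
  by exists (k * k'^-1)%g; rewrite groupM ?groupV // mulgA e mulgK.
have r1 : r = 1%g.
  have := minrepsP _ _ wK' r^-1%g; rewrite groupV => /(_ rK).
  rewrite wE mulgK (len_minreps wK rK) => le; apply/eqP.
  by rewrite -len_eq0 -leqn0 -(leq_add2l (len w)) addn0.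
by move: e; rewrite wE r1 mulg1 => /mulgI ->.
Qed.

End Exchange.

(** * The parabolic subalgebra, and the Hecke algebra as a free right module over it *)

Section ParabolicSubalgebra.
Variables (m : nat) (H : heckeAlgebra m) (K : {set 'I_m.+1}).
Local Notation W := 'S_m.+2.
Implicit Types (v w k x : W) (h : H).

Lemma in_parabolicP h :
  in_parabolic K h <-> forall v, v \notin parabolic K -> hcoord h v = 0.
Proof.
split=> [[c ->] v vK|hP].
  rewrite hcoord_sum big1 // => w wK; rewrite hcoordZ hcoordT ffunE.
  by case: eqP vK => [->|]; rewrite ?wK ?mulr0.
exists (hcoord h); rewrite -{1}(hcoordK h) (bigID (mem (parabolic K))) /=.
by rewrite [X in _ + X]big1 ?addr0 // => v /hP ->; rewrite scale0r.
Qed.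

Lemma in_parabolic0 : in_parabolic K (0 : H).
Proof. by apply/in_parabolicP => v _; rewrite hcoord0. Qed.

Lemma in_parabolicD h h' :
  in_parabolic K h -> in_parabolic K h' -> in_parabolic K (h + h').
Proof.
move=> /in_parabolicP hP /in_parabolicP hP'; apply/in_parabolicP => v vK.
by rewrite hcoordD hP // hP' // addr0.
Qed.

Lemma in_parabolicZ a h : in_parabolic K h -> in_parabolic K (a *: h).
Proof.
by move=> /in_parabolicP hP; apply/in_parabolicP => v vK; rewrite hcoordZ hP ?mulr0.
Qed.

Lemma in_parabolicT k : k \in parabolic K -> in_parabolic K (T k : H).
Proof.
move=> kK; apply/in_parabolicP => v vK; rewrite hcoordT ffunE.
by case: eqP vK => [->|//]; rewrite kK.
Qed.

Lemma in_parabolic_ind (P : H -> Prop) :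
    P 0 -> (forall h h', P h -> P h' -> P (h + h')) ->
    (forall a h, P h -> P (a *: h)) -> (forall k, k \in parabolic K -> P (T k)) ->
  forall h, in_parabolic K h -> P h.
Proof.
move=> P0 PD PZ PT _ [c ->]; apply: big_ind => // k kK; exact/PZ/PT.
Qed.

Lemma in_parabolicMT h t : t \in K -> in_parabolic K h ->
  in_parabolic K (h * T (simple t)).
Proof.
move=> tK; have tP := parabolic_simple tK; move: h.
apply: in_parabolic_ind => [|h h' hP hP'|a h hP|k kK].
- by rewrite mul0r; exact: in_parabolic0.
- by rewrite mulrDl; exact: in_parabolicD.
- by rewrite -scalerAl; exact: in_parabolicZ.
have ktK : (k * simple t)%g \in parabolic K by rewrite groupM.
have [lk|lk] := len_simpler k t.
  by rewrite T_upr //; exact: in_parabolicT.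
by rewrite T_downr //; apply: in_parabolicD;
  [apply/in_parabolicZ/in_parabolicT|exact: in_parabolicT].
Qed.

Lemma in_parabolicM h h' : in_parabolic K h -> in_parabolic K h' ->
  in_parabolic K (h * h').
Proof.
move=> hP; move: h'; apply: in_parabolic_ind => [|h1 h2 P1 P2|a h1 P1|k kK].
- by rewrite mulr0; exact: in_parabolic0.
- by rewrite mulrDr; exact: in_parabolicD.
- by rewrite -scalerAr; exact: in_parabolicZ.
move: k kK h hP; apply: parabolic_ind => [|k t kK tK IHk] h hP.
  by rewrite T1 mulr1.
have [lk|lk] := len_simpler k t.
  by rewrite -(T_upr _ lk) mulrA; apply/in_parabolicMT/IHk.
(* When t shortens k, $T_{kt}=T_kT_t^{-1}$, and $T_t^{-1}=T_t-(u-u^{-1})$. *)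
have e : T (k * simple t)%g = T k * (T (simple t) - (upow 1 - upow (-1))%:A) :> H.
  have -> : T k = T (k * simple t)%g * T (simple t) :> H by rewrite T_upr simpleKr.
  by rewrite -mulrA T_simple_inv mulr1.
rewrite e mulrA mulrBr; apply: in_parabolicD; first by apply/in_parabolicMT/IHk.
rewrite -scaleN1r; apply: in_parabolicZ; rewrite -scalerAr mulr1.
exact/in_parabolicZ/IHk.
Qed.

Lemma T_minreps x k : x \in minreps K -> k \in parabolic K ->
  T x * T k = T (x * k)%g :> H.
Proof. by move=> xK kK; rewrite T_mul // (len_minreps H xK kK). Qed.

(* As a right H_K-module, H is free on the T_w with w in W^K; this is the
   coordinate at w. *)
Definition hpart w h : H := \sum_(k in parabolic K) hcoord h (w * k)%g *: T k.

Lemma hpartD w h h' : hpart w (h + h') = hpart w h + hpart w h'.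
Proof.
by rewrite -big_split; apply: eq_bigr => k _; rewrite hcoordD scalerDl.
Qed.

Lemma hpartZ w a h : hpart w (a *: h) = a *: hpart w h.
Proof.
by rewrite scaler_sumr; apply: eq_bigr => k _; rewrite hcoordZ scalerA.
Qed.

Lemma hpart0 w : hpart w 0 = 0.
Proof. by apply: (addrI (hpart w 0)); rewrite -hpartD !addr0. Qed.

Lemma hpart_sum w (I : Type) (r : seq I) (P : pred I) (F : I -> H) :
  hpart w (\sum_(i <- r | P i) F i) = \sum_(i <- r | P i) hpart w (F i).
Proof. exact: (big_morph (hpart w) (hpartD w) (hpart0 w)). Qed.

Lemma hpart_in w h : in_parabolic K (hpart w h).
Proof. by exists (fun k => hcoord h (w * k)%g). Qed.

Lemma hpartTM w x h : w \in minreps K -> x \in minreps K -> in_parabolic K h ->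
  hpart w (T x * h) = if x == w then h else 0.
Proof.
move=> wK xK; move: h; apply: in_parabolic_ind => [|h h' hP hP'|a h hP|k kK].
- by rewrite mulr0 hpart0 if_same.
- by rewrite mulrDr hpartD hP hP'; case: ifP; rewrite ?addr0.
- by rewrite -scalerAr hpartZ hP; case: ifP; rewrite ?scaler0.
rewrite T_minreps // /hpart; case: eqP => [<-|xw].
  rewrite (bigD1 k) //= hcoordT ffunE eqxx scale1r big1 ?addr0 // => k' /andP[k'K k'k].
  by rewrite ffunE (inj_eq (mulgI x)) (negPf k'k) scale0r.
rewrite big1 // => k' k'K; rewrite hcoordT ffunE.
case: eqP => [e|_]; last by rewrite scale0r.
by have [] := minreps_uniq H wK xK k'K kK e; move/esym.
Qed.

(** By linearity it suffices to treat $T_v$ with v = w k, w in W^K and k in W_K; there $T_v=T_wT_k$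
    and only the summand at w survives. *)
Lemma hpart_decomp h : h = \sum_(x in minreps K) T x * hpart x h.
Proof.
rewrite -[in LHS](hcoordK h) -[in RHS](hcoordK h).
under [in RHS]eq_bigr => x _ do rewrite hpart_sum mulr_sumr.
rewrite exchange_big /=; apply: eq_bigr => v _.
under eq_bigr => x _ do rewrite hpartZ -scalerAr.
rewrite -scaler_sumr; congr (_ *: _).
have [w [k [wK kK ->]]] := minreps_decomp K v.
rewrite (bigD1 w) //= -T_minreps // hpartTM ?eqxx //; last exact: in_parabolicT.
rewrite big1 ?addr0 // => x /andP[xK xw].
by rewrite hpartTM //; [rewrite eq_sym (negPf xw) mulr0|exact: in_parabolicT].
Qed.

(** This right linearity over H_K makes [tcoord] below respect the balancing relation of the tensor
    product. *)
Lemma hpartM w h h' : w \in minreps K -> in_parabolic K h' ->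
  hpart w (h * h') = hpart w h * h'.
Proof.
move=> wK h'K; rewrite {1}(hpart_decomp h) mulr_suml hpart_sum (bigD1 w) //=.
rewrite -mulrA hpartTM ?eqxx //; last exact/in_parabolicM/h'K/hpart_in.
rewrite big1 ?addr0 // => x /andP[xK xw].
by rewrite -mulrA hpartTM ?(negPf xw) //; exact/in_parabolicM/h'K/hpart_in.
Qed.

End ParabolicSubalgebra.

(** * Unitriangularity of bar for the length *)

Section Triangularity.
Variables (m : nat) (H : heckeAlgebra m).
Local Notation W := 'S_m.+2.
Implicit Types (v w x y : W) (h : H).

Definition shorter (n : nat) h : Prop :=
  forall y, (n <= len y)%N -> hcoord h y = 0.

Lemma shorterD n h h' : shorter n h -> shorter n h' -> shorter n (h + h').
Proof. by move=> hP hP' y ny; rewrite hcoordD hP // hP' // addr0. Qed.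

Lemma shorterZ n a h : shorter n h -> shorter n (a *: h).
Proof. by move=> hP y ny; rewrite hcoordZ hP ?mulr0. Qed.

Lemma shorterW n n' h : (n <= n')%N -> shorter n h -> shorter n' h.
Proof. by move=> nn' hP y ny; apply: hP; apply: leq_trans ny. Qed.

Lemma shorterT n x : (len x < n)%N -> shorter n (T x).
Proof.
move=> xn y ny; rewrite hcoordT ffunE; case: eqP => // yx.
by move: xn; rewrite -yx ltnNge ny.
Qed.

Lemma shorter_sum n (I : Type) (r : seq I) (P : pred I) (F : I -> H) :
  (forall i, P i -> shorter n (F i)) -> shorter n (\sum_(i <- r | P i) F i).
Proof.
apply: big_ind; first by move=> y _; rewrite hcoord0.
exact: shorterD.
Qed.

Lemma shorter_simpleM n s h : shorter n h -> shorter n.+1 (T (simple s) * h).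
Proof.
move=> hP; rewrite -(hcoordK h) mulr_sumr; apply: shorter_sum => y _.
rewrite -scalerAr; have [ny|yn] := leqP n (len y).
  by rewrite hP // scale0r => z _; rewrite hcoord0.
apply: shorterZ; have [l|l] := len_simple s y.
  by rewrite T_up //; apply: shorterT; rewrite l.
rewrite T_down //; apply: shorterD; first by apply/shorterZ/shorterT; rewrite ltnW.
by apply: shorterT; rewrite ltnS ltnW // (leq_trans _ yn) // l.
Qed.

(** For x = s y longer than y,
    $\overline{T_x}-T_x=T_s(\overline{T_y}-T_y)-(u-u^{-1})\overline{T_y}$, and both terms live in
    lengths below $\ell(x)$. *)
Lemma hbarT_shorter x : shorter (len x) (hbar (T x : H) - T x).
Proof.
elim: {x}(len x) {-2}x (erefl (len x)) => [|n IHn] x lx.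
  move/eqP: lx; rewrite len_eq0 => /eqP->.
  by rewrite T1 hbar1 subrr => y _; rewrite hcoord0.
have [x1|/len_descent[s sx]] := eqVneq x 1%g; first by rewrite x1 len1 in lx.
pose y : W := (simple s * x)%g; have xE : x = (simple s * y)%g by rewrite simpleK.
have ly : len y = n by apply: succn_inj; rewrite -lx sx.
have xT : T x = T (simple s) * T y :> H by rewrite xE T_up // -xE lx ly.
have yP := IHn y ly; rewrite xT hbar_simpleM T_simpleV.
rewrite (_ : _ - _ = T (simple s) * (hbar (T y) - T y)
  - (upow 1 - upow (-1)) *: (hbar (T y) - T y + T y)); last first.
  by rewrite subrK mulrBl mulrBr -scalerAl mul1r addrAC.
rewrite ly in yP; apply: shorterD; first by rewrite lx; exact: shorter_simpleM.
rewrite -scaleNr; apply: shorterZ; apply: shorterD.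
  by apply: shorterW yP; rewrite lx.
by apply: shorterT; rewrite lx ly.
Qed.

Variable K : {set 'I_m.+1}.

Lemma hpart_shorter w h : w \in minreps K -> shorter (len w) h -> hpart K w h = 0.
Proof.
move=> wK hP; rewrite /hpart big1 // => k kK.
by rewrite hP ?scale0r // (len_minreps H wK kK) leq_addr.
Qed.

(** The lower terms of $\overline{T_x}$ are shorter than x, while every element of w W_K has length
    at least $\ell(w)\ge\ell(x)$. *)
Lemma hpart_hbarT w x : w \in minreps K -> x \in minreps K -> (len x <= len w)%N ->
  hpart K w (hbar (T x : H)) = if x == w then 1 else 0.
Proof.
move=> wK xK xw; rewrite -(subrK (T x) (hbar _)) hpartD hpart_shorter //; last first.
  by apply: shorterW xw _; exact: hbarT_shorter.
rewrite add0r -[T x]mulr1 hpartTM //.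
by rewrite -(T1 H); apply/in_parabolicT/group1.
Qed.

End Triangularity.

Local Notation act := Defs.act.

(* Otherwise unification unfolds the quotient defining the tensor product. *)
Opaque hbar hpart gbar pure tbar tproj.

Lemma mcoeff_sum (G : choiceType) (d : G) (I : Type) (r : seq I) (P : pred I)
    (F : I -> {malg A[G]}) :
  (\sum_(i <- r | P i) F i)@_d = \sum_(i <- r | P i) (F i)@_d.
Proof. exact: raddf_sum. Qed.

(** * The action on $A\Gamma$ and supports *)

Section Action.
Variables (m : nat) (H : heckeAlgebra m) (G : wgraph H).
Local Notation AG := {malg A[G]}.
Implicit Types (h : H) (e : AG).

Lemma act0l e : act (0 : H) e = 0.
Proof. by apply: (addrI (act 0 e)); rewrite -actDl !addr0. Qed.

Lemma act0r h : act h (0 : AG) = 0.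
Proof. by apply: (addrI (act h 0)); rewrite -actDr !addr0. Qed.

Definition supp_in (P : pred G) e : Prop := forall d, ~~ P d -> e@_d = 0.

End Action.

(** * Coordinates in the tensor product *)

Section Coordinates.
Variables (m : nat) (H : heckeAlgebra m) (G : wgraph H) (K : {set 'I_m.+1}).
Local Notation W := 'S_m.+2.
Local Notation AG := {malg A[G]}.
Local Notation M := (tensor G K).
Implicit Types (w x : W) (h : H) (e : AG) (z : M).

Lemma pure0l e : pure 0 e = 0 :> M.
Proof. by rewrite -(scale0r (0 : H)) pureZl scale0r. Qed.

Lemma pure0r h : pure h 0 = 0 :> M.
Proof. by rewrite -(scale0r (0 : AG)) pureZr scale0r. Qed.

Lemma pure_suml (I : Type) (r : seq I) (P : pred I) (F : I -> H) e :
  pure (\sum_(i <- r | P i) F i) e = \sum_(i <- r | P i) pure (F i) e :> M.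
Proof.
exact: (big_morph (fun h => pure h e) (fun h h' => pureDl K h h' e) (pure0l e)).
Qed.

Lemma pure_sumr h (I : Type) (r : seq I) (P : pred I) (F : I -> AG) :
  pure h (\sum_(i <- r | P i) F i) = \sum_(i <- r | P i) pure h (F i) :> M.
Proof.
exact: (big_morph (fun e => pure h e) (fun e e' => pureDr K h e e') (pure0r h)).
Qed.

(** Scalars are absorbed by the left factor, so every tensor is a plain sum of pure tensors. *)
Lemma tensor_ind (P : M -> Prop) :
    (forall h e, P (pure h e)) -> (forall z z', P z -> P z' -> P (z + z')) ->
  forall z, P z.
Proof.
move=> Pp PD z; have tpi_sum := big_morph (@tpi m H G K) (@tpiD m H G K).
rewrite -(tpiK z); move: (generic_quotient.repr _) => y.
have -> : y = \sum_(p <- msupp y) y@_p *: << p >>.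
  rewrite {1}[y]monalgE; apply: eq_bigr => k _.
  by apply/malgP => j; rewrite mcoeffZ !mcoeffU mulrnAr mulr1.
rewrite (tpi_sum 0); last by rewrite -(scale0r 0) tpiZ scale0r.
apply: big_ind => // [|[h e] _]; first by rewrite -(pure0l 0).
by rewrite tpiZ -/(pure h e) -pureZl.
Qed.

(** The component at w of the decomposition of the tensor product into the summands $T_w\boxtimes
    A\Gamma$, w in W^K. *)
Definition tcoord w z : AG :=
  tlift idfun (fun p : H * AG => act (hpart K w p.1) p.2) z.

Section CoordTheory.
Variable w : W.
Hypothesis wK : w \in minreps K.

Let tcoordP :
  let f (p : H * AG) := act (hpart K w p.1) p.2 in
  [/\ forall h h' e, f (h + h', e) = f (h, e) + f (h', e),
      forall h e e', f (h, e + e') = f (h, e) + f (h, e'),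
      forall a h e, f (a *: h, e) = a *: f (h, e),
      forall a h e, f (h, a *: e) = a *: f (h, e) &
      forall h k e, in_parabolic K k -> f (h * k, e) = f (h, act k e)].
Proof.
split=> /= [h h' e|h e e'|a h e|a h e|h k e kK].
- by rewrite hpartD actDl.
- by rewrite actDr.
- by rewrite hpartZ actZl.
- by rewrite actZr.
- by rewrite hpartM // Defs.actM.
Qed.

Lemma tcoordD : {morph tcoord w : z z' / z + z'}.
Proof.
case: tcoordP => fDl fDr fZl fZr fK.
exact: (tliftD (sigma := idfun)
  (f := (fun p : H * AG => act (hpart K w p.1) p.2)) fDl fDr fZl fZr fK).
Qed.

Lemma tcoordZ a z : tcoord w (a *: z) = a *: tcoord w z.
Proof.
case: tcoordP => fDl fDr fZl fZr fK.
exact: (tliftZ (sigma := idfun)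
  (f := (fun p : H * AG => act (hpart K w p.1) p.2)) fDl fDr fZl fZr fK).
Qed.

Lemma tcoord_pure h e : tcoord w (pure h e) = act (hpart K w h) e.
Proof.
case: tcoordP => fDl fDr fZl fZr fK.
exact: (tlift_pure (sigma := idfun)
  (f := (fun p : H * AG => act (hpart K w p.1) p.2)) fDl fDr fZl fZr fK).
Qed.

Lemma tcoord0 : tcoord w 0 = 0.
Proof. by rewrite -(scale0r 0) tcoordZ scale0r. Qed.

Lemma tcoordN z : tcoord w (- z) = - tcoord w z.
Proof. by rewrite -scaleN1r tcoordZ scaleN1r. Qed.

Lemma tcoordB z z' : tcoord w (z - z') = tcoord w z - tcoord w z'.
Proof. by rewrite tcoordD tcoordN. Qed.

Lemma tcoord_sum (I : Type) (r : seq I) (P : pred I) (F : I -> M) :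
  tcoord w (\sum_(i <- r | P i) F i) = \sum_(i <- r | P i) tcoord w (F i).
Proof. exact: (big_morph (tcoord w) tcoordD tcoord0). Qed.

Lemma tcoord_pureT x e : x \in minreps K ->
  tcoord w (pure (T x) e) = if x == w then e else 0.
Proof.
move=> xK; rewrite tcoord_pure -[T x]mulr1 hpartTM //.
  by case: eqP => _; rewrite ?Defs.act1 ?act0l.
by rewrite -(T1 H); apply/in_parabolicT/group1.
Qed.

End CoordTheory.

Lemma tcoord_sumT w (e : W -> AG) : w \in minreps K ->
  tcoord w (\sum_(x in minreps K) pure (T x) (e x)) = e w.
Proof.
move=> wK; rewrite (tcoord_sum wK) (bigD1 w wK) big1.
  by rewrite /= addr0; apply: etrans (tcoord_pureT wK _ wK) _; rewrite eqxx.
move=> x /andP[xK xw]; apply: etrans (tcoord_pureT wK _ xK) _.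
by rewrite (negPf xw).
Qed.

Opaque tcoord.

(** On h (x) e, decompose h by [hpart_decomp] and move each [hpart], an element of H_K, across the
    tensor sign. *)
Lemma tensor_decomp z : z = \sum_(w in minreps K) pure (T w) (tcoord w z).
Proof.
move: z; apply: tensor_ind => [h e|z z' zE zE']; last first.
  rewrite {1}zE {1}zE' -big_split; apply: eq_bigr => w wK.
  by rewrite tcoordD // pureDr.
rewrite {1}(hpart_decomp K h) pure_suml; apply: eq_bigr => w wK.
rewrite (tcoord_pure wK); apply: pureK; exact: hpart_in.
Qed.

Lemma tbar0 : tbar (0 : M) = 0.
Proof. by have := tbarZ 0 (0 : M); rewrite rmorph0 !scale0r. Qed.

Lemma tbarB z z' : tbar (z - z') = tbar z - tbar z'.
Proof. by rewrite -scaleN1r tbarD tbarZ rmorphN1 scaleN1r. Qed.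

Lemma tbar_sum (I : Type) (r : seq I) (P : pred I) (F : I -> M) :
  tbar (\sum_(i <- r | P i) F i) = \sum_(i <- r | P i) tbar (F i).
Proof. exact: (big_morph _ (@tbarD m H G K) tbar0). Qed.

Lemma tcoord_tbar z w : w \in minreps K ->
  tcoord w (tbar z) =
  \sum_(x in minreps K) act (hpart K w (hbar (T x))) (gbar (tcoord x z)).
Proof.
move=> wK; rewrite {1}(tensor_decomp z) tbar_sum (tcoord_sum wK).
by apply: eq_bigr => x _; rewrite tbar_pure (tcoord_pure wK).
Qed.

(* bar is unitriangular for the length, so an outermost coordinate outside P
   is bar-invariant. *)
Lemma bar_invariant_supp (P : pred G) z :
    (forall k e, in_parabolic K k -> supp_in P e -> supp_in P (act k e)) ->
    tbar z = z ->
    (forall w d, w \in minreps K -> ~~ P d -> uVAminus (tcoord w z)@_d) ->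
  forall w, w \in minreps K -> supp_in P (tcoord w z).
Proof.
move=> stab zbar zP; pose N := (\sum_w len (w : W))%N.
have lenN (w : W) : (len w <= N)%N by rewrite /N (bigD1 w) //= leq_addr.
(* Downward induction on the length of w, starting above the bound N on all lengths. *)
suff supp n w : (N < len w + n)%N -> w \in minreps K -> supp_in P (tcoord w z).
  by move=> w; apply: (supp N.+1); rewrite addnS ltnS leq_addl.
elim: n w => [|n IHn] w; first by rewrite addn0 ltnNge lenN.
move=> wn wK d dP; apply: uVAminus_lbar; first exact: zP.
have diag : (act (hpart K w (hbar (T w))) (gbar (tcoord w z)))@_d = lbar (tcoord w z)@_d.
  by rewrite (hpart_hbarT H wK wK (leqnn _)) eqxx Defs.act1 gbarE.
(* An x other than w and no longer than w contributes nothing, by unitriangularity; a longer x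
   contributes a vector supported in P, by induction and stability. *)
have off x : x \in minreps K -> x != w ->
    (act (hpart K w (hbar (T x))) (gbar (tcoord x z)))@_d = 0.
  move=> xK xw; have [le|lt] := leqP (len x) (len w).
    by rewrite (hpart_hbarT H wK xK le) (negPf xw) act0l mcoeff0.
  apply: stab dP; first exact: hpart_in.
  move=> d' d'P; rewrite gbarE (IHn x _ xK) ?rmorph0 //.
  by apply: leq_trans wn _; rewrite addnS -addSn leq_add2r.
rewrite -{2}zbar (tcoord_tbar _ wK) mcoeff_sum (bigD1 w wK) /= big1.
  by rewrite addr0; exact/esym/diag.
by move=> x /andP[]; exact: off.
Qed.

Lemma tensor_eq0 z : (forall w, w \in minreps K -> tcoord w z = 0) -> z = 0.
Proof.
by move=> z0; rewrite (tensor_decomp z) big1 // => w wK; rewrite z0 // pure0r.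
Qed.

(** The case of the empty set of vertices, whose span is the stable submodule 0. *)
Lemma bar_invariant_eq0 z : tbar z = z ->
    (forall w d, w \in minreps K -> uVAminus (tcoord w z)@_d) -> z = 0.
Proof.
move=> zbar zP; apply: tensor_eq0 => w wK; apply/malgP => d; rewrite mcoeff0.
apply: (@bar_invariant_supp pred0 z) => // [k e kK e0 d' _|w' d' wK' _]; last exact: zP.
have -> : e = 0 by apply/malgP => d''; rewrite mcoeff0 e0.
by rewrite act0r mcoeff0.
Qed.

End Coordinates.

Lemma tproj_tbar (m : nat) (H : heckeAlgebra m) (G : wgraph H)
    (K K' : {set 'I_m.+1}) (z : tensor G K) : K \subset K' ->
  tproj K K' (tbar z) = tbar (tproj K K' z).
Proof.
move=> KK'; move: z; apply: tensor_ind => [h e|z z' zE zE'].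
  have -> : tproj K K' (pure h e) = pure h e by exact: tproj_pure.
  have -> : tbar (pure h e) = pure (hbar h) (gbar e) :> tensor G K.
    exact: tbar_pure.
  have -> : tbar (pure h e) = pure (hbar h) (gbar e) :> tensor G K'.
    exact: tbar_pure.
  exact: tproj_pure.
have -> : tproj K K' (z + z') = tproj K K' z + tproj K K' z' by exact: tprojD.
have -> : tbar (z + z') = tbar z + tbar z' by exact: tbarD.
have -> : tproj K K' (tbar z + tbar z') = tproj K K' (tbar z) + tproj K K' (tbar z').
  exact: tprojD.
exact: etrans (congr2 +%R zE zE') (esym (tbarD _ _)).
Qed.

(** * The first reflection, its commutation with $W_{J'_{n-2}}$, and its descent vertices *)

Section FirstReflection.
Variables (m : nat) (H : heckeAlgebra m).
Local Notation W := 'S_m.+2.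
Local Notation S := 'I_m.+1.
Local Notation s1 := (ord0 : 'I_m.+1).
Local Notation J := (Jprime m).
Local Notation K2 := (Sminus2 m).
Implicit Types (w x k : W) (h : H).

Lemma simple_s1_comm (t : S) : t \in J ->
  (simple s1 * simple t = simple t * simple s1)%g.
Proof.
rewrite inE => t2; rewrite conjgC; congr (_ * _)%g.
by rewrite /simple tpermJ !tpermD // -val_eqE /=; rewrite /bump; lia.
Qed.

Lemma parabolicJ_comm k : k \in parabolic J -> (simple s1 * k = k * simple s1)%g.
Proof.
move: k; apply: parabolic_ind => [|k t kJ tJ IHk]; first by rewrite mulg1 mul1g.
by rewrite mulgA IHk -mulgA simple_s1_comm // mulgA.
Qed.

(** The subgroup fixes the letter 0, which $s_1$ moves. *)
Lemma s1_notin_parabolicJ : simple s1 \notin parabolic J.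
Proof.
have fix0 k : k \in parabolic J -> k ord0 = ord0.
  move: k; apply: parabolic_ind => [|k t kJ]; first by rewrite perm1.
  by rewrite inE => t2 k0; rewrite permM k0 tpermD // -val_eqE /=; rewrite ?/bump; lia.
apply/negP => /fix0; rewrite /simple (_ : widen_ord _ _ = ord0); last exact: val_inj.
by rewrite tpermL.
Qed.

(** Having length 1 and lying outside $W_{J'_{n-2}}$, $s_1$ is a minimal representative, so lengths
    add. *)
Lemma len_s1_mul k : k \in parabolic J -> len (simple s1 * k)%g = (len k).+1.
Proof.
move=> kJ; rewrite (len_minreps H (K := J)) ?len_simple1 ?add1n //.
apply/minrepsP => x xJ; rewrite len_simple1 lt0n len_eq0.
apply: contra s1_notin_parabolicJ => /eqP e.
by rewrite -(mulgK x (simple s1)) e mul1g groupV.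
Qed.

Lemma len_mul_s1 k : k \in parabolic J -> len (k * simple s1)%g = (len k).+1.
Proof. by move=> kJ; rewrite -parabolicJ_comm // len_s1_mul. Qed.

Lemma Cs_commJ h : in_parabolic J h -> Cs H s1 * h = h * Cs H s1.
Proof.
move: h; apply: in_parabolic_ind => [|h h' hP hP'|a h hP|k kJ].
- by rewrite mulr0 mul0r.
- by rewrite mulrDr hP hP' mulrDl.
- by rewrite -scalerAr hP scalerAl.
rewrite /Cs mulrDl mulrDr T_up ?len_s1_mul // T_upr ?len_mul_s1 //.
by rewrite parabolicJ_comm // -scalerAl -scalerAr mul1r mulr1.
Qed.

(** Since $C'_s-[2]=T_s-u$, this is the quadratic relation. *)
Lemma Cs_sqr (s : S) : Cs H s * Cs H s = qtwo *: Cs H s.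
Proof.
apply/eqP; rewrite -subr_eq0 -[qtwo *: _]mulr_algl -mulrBl; apply/eqP.
by rewrite -(T_quad H s) /Cs /qtwo scalerDl opprD [- _ - _]addrC addrA addrK.
Qed.

Lemma parabolicJ_sub : {subset parabolic J <= parabolic K2}.
Proof. by apply/subsetP; rewrite genS // imsetS // Jprime_sub. Qed.

Lemma s1_in_K2 : s1 \in K2. Proof. by rewrite inE. Qed.

Lemma parabolicK2 x : x \in parabolic K2 ->
  exists2 k, k \in parabolic J & x = k \/ x = (k * simple s1)%g.
Proof.
move: x; apply: parabolic_ind => [|x t _ tK [k kJ xE]].
  by exists 1%g; [exact: group1|left].
have [->|t0] := eqVneq t s1.
  by exists k => //; case: xE => ->; [right|left; rewrite simpleKr].
have tJ : t \in J by move: tK t0; rewrite !inE -val_eqE /=; lia.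
exists (k * simple t)%g; first by rewrite groupM // parabolic_simple.
by case: xE => ->; [left|right; rewrite -!mulgA simple_s1_comm].
Qed.

(** The subalgebra for S \ s_2 is $\mathscr H_{J'_{n-2}}+\mathscr H_{J'_{n-2}}C'_{s_1}$, because
    $T_{ks_1}=T_kC'_{s_1}-u^{-1}T_k$ for k in $W_{J'_{n-2}}$. *)
Lemma in_parabolicK2_ind (P : H -> Prop) :
    (forall h h', P h -> P h' -> P (h + h')) ->
    (forall h, in_parabolic J h -> P h) ->
    (forall h, in_parabolic J h -> P (h * Cs H s1)) ->
  forall h, in_parabolic K2 h -> P h.
Proof.
move=> PD PJ PC _ [c ->]; apply: big_ind => // [|x /parabolicK2[k kJ [->|->]]].
- exact/PJ/in_parabolic0.
- exact/PJ/in_parabolicZ/in_parabolicT.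
have -> : T (k * simple s1)%g = T k * Cs H s1 - upow (-1) *: T k.
  by rewrite /Cs mulrDr T_upr ?len_mul_s1 // -scalerAr mulr1 addrK.
rewrite scalerBr -scalerN -scaleNr scalerAl; apply: PD.
  exact/PC/in_parabolicZ/in_parabolicT.
exact/PJ/in_parabolicZ/in_parabolicZ/in_parabolicT.
Qed.

Lemma Cs_commK2 h : in_parabolic K2 h -> Cs H s1 * h = h * Cs H s1.
Proof.
move: h; apply: in_parabolicK2_ind => [h h' hP hP'|h hJ|h hJ].
- by rewrite mulrDr hP hP' mulrDl.
- exact: Cs_commJ.
by rewrite mulrA Cs_commJ.
Qed.

Lemma in_parabolic_Cs : in_parabolic K2 (Cs H s1).
Proof.
apply: in_parabolicD; first exact/in_parabolicT/parabolic_simple/s1_in_K2.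
by rewrite -(T1 H); apply/in_parabolicZ/in_parabolicT/group1.
Qed.

Lemma minrepsK2_J w : w \in minreps K2 -> w \in minreps J.
Proof.
by move/minrepsP => wK; apply/minrepsP => x xJ; exact/wK/parabolicJ_sub.
Qed.

Lemma len_minreps_s1 w : w \in minreps K2 -> len (w * simple s1)%g = (len w).+1.
Proof.
by move=> wK; rewrite (len_minreps H wK) ?len_simple1 ?addn1 ?parabolic_simple ?s1_in_K2.
Qed.

Lemma minreps_s1 w : w \in minreps K2 -> (w * simple s1)%g \in minreps J.
Proof.
move=> wK; have s1K := parabolic_simple s1_in_K2; apply/minrepsP => x xJ.
rewrite -mulgA (len_minreps H wK s1K).
rewrite (len_minreps H wK (groupM s1K (parabolicJ_sub xJ))).
by rewrite leq_add2l len_s1_mul // len_simple1.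
Qed.

(** The shorter of x and $xs_1$ is minimal in its coset of $W_{S\setminus s_2}$, that coset being
    the union of $xW_{J'_{n-2}}$ and $xW_{J'_{n-2}}s_1$. *)
Lemma minrepsJ_cases x : x \in minreps J ->
  x \in minreps K2 \/ exists2 w, w \in minreps K2 & x = (w * simple s1)%g.
Proof.
move=> xJ; have len_xk k : k \in parabolic J -> len (x * k)%g = (len x + len k)%N.
  exact: (len_minreps H xJ).
have bound w : (len w <= len x)%N -> (len w <= len (x * simple s1)%g)%N ->
    forall k, k \in parabolic K2 -> (len w <= len (x * k)%g)%N.
  move=> wx wxs _ /parabolicK2[k kJ [->|->]].
    by rewrite len_xk // (leq_trans wx) ?leq_addr.
  (* For k = 1 this is the second hypothesis; otherwise
     $\ell(xks_1)\ge\ell(x)+\ell(k)-1\ge\ell(x)$. *)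
  have [->|k1] := eqVneq k 1%g; first by rewrite mul1g.
  have kp : (0 < len k)%N by rewrite lt0n len_eq0.
  apply: leq_trans wx _; rewrite mulgA.
  have := len_xk k kJ; case: (len_simpler (x * k)%g s1) => -> e.
    by rewrite ltnW // ltnS e leq_addr.
  by rewrite -ltnS e -addn1 leq_add2l.
have [lx|lx] := len_simpler x s1.
  left; apply/minrepsP => k kK; apply: bound => //.
  by rewrite lx.
right; exists (x * simple s1)%g; last by rewrite simpleKr.
apply/minrepsP => k kK; rewrite -mulgA; apply: bound => //.
  by rewrite lx.
by rewrite groupM ?parabolic_simple ?s1_in_K2.
Qed.

Lemma T_minreps_s1 w : w \in minreps K2 ->
  T (w * simple s1)%g = T w * T (simple s1) :> H.
Proof. by move=> wK; rewrite T_upr // len_minreps_s1. Qed.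

Variable G : wgraph H.
Local Notation AG := {malg A[G]}.
Implicit Types (e : AG) (d c : G).

Definition s1desc : pred G := [pred d : G | s1 \in desc d].

Lemma coef_actCs e d : ~~ s1desc d -> (act (Cs H s1) e)@_d = 0.
Proof.
move=> dP; rewrite {1}(malg_span e) act_sum mcoeff_sum big1 // => c _.
rewrite actZr mcoeffZ; have [cP|cP] := boolP (s1 \in desc c).
  rewrite act_desc // mcoeffZ mcoeffU; case: eqP => [cd|_]; last by rewrite !mulr0.
  by case/negP: dP; rewrite -cd.
by rewrite act_ndesc // (negPf (dP : s1 \notin desc d)) mulr0.
Qed.

(** The span of the vertices with $s_1$ in their descent set is the [2]-eigenspace of $C'_{s_1}$:
    the image of $C'_{s_1}$ lies in that span, and [2] is not a zero divisor. *)
Lemma supp_s1descP e : supp_in s1desc e <-> act (Cs H s1) e = qtwo *: e.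
Proof.
split=> [eP|eE d dP]; last first.
  by apply: qtwo_reg; rewrite -mcoeffZ -eE coef_actCs.
rewrite (malg_span e) act_sum scaler_sumr big_seq [RHS]big_seq.
apply: eq_bigr => d; rewrite actZr -mcoeff_neq0 => d0.
have dP : s1 \in desc d by apply: contraNT d0 => /eP ->.
by rewrite (act_desc dP) !scalerA mulrC.
Qed.

(** An eigenspace of a central element is stable. *)
Lemma supp_s1desc_act (k : H) e : in_parabolic K2 k ->
  supp_in s1desc e -> supp_in s1desc (act k e).
Proof.
move=> kK /supp_s1descP eE; apply/supp_s1descP.
rewrite -Defs.actM (Cs_commK2 kK) Defs.actM eE; exact: actZr.
Qed.

Lemma coef_actT c d : (act (T (simple s1) : H) << c >>)@_d =
  if s1desc c then upow 1 * (c == d)%:R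
  else (if s1desc d then (mu d c)%:~R else 0) - upow (-1) * (c == d)%:R.
Proof.
have -> : T (simple s1) = Cs H s1 + (- upow (-1))%:A.
  by rewrite /Cs scaleNr addrK.
rewrite actDl actZl Defs.act1 mcoeffD mcoeffZ mcoeffU mulNr.
case: ifP => [cP|/negbT cP]; last by rewrite (act_ndesc cP).
by rewrite (act_desc cP) mcoeffZ mcoeffU -mulrBl /qtwo addrK.
Qed.

End FirstReflection.

(** * Coordinatewise bounds *)

Section Bounds.
Variables (m : nat) (H : heckeAlgebra m) (G : wgraph H) (K : {set 'I_m.+1}).
Variable B : G -> A -> Prop.
Hypotheses (B0 : forall d, B d 0) (BD : forall d a b, B d a -> B d b -> B d (a + b))
  (BN : forall d a, B d a -> B d (- a)).
Local Notation M := (tensor G K).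
Implicit Types (z : M) (w : 'S_m.+2).

(** The bound may vary with the vertex, as it will according to whether $s_1$ is a descent. *)
Definition coord_in z : Prop :=
  forall w d, w \in minreps K -> B d (tcoord w z)@_d.

Lemma coord_inD z z' : coord_in z -> coord_in z' -> coord_in (z + z').
Proof.
move=> zP zP' w d wK; rewrite (tcoordD wK) mcoeffD.
by apply: BD; [exact: zP|exact: zP'].
Qed.

Lemma coord_inN z : coord_in z -> coord_in (- z).
Proof. by move=> zP w d wK; rewrite (tcoordN wK) mcoeffN; apply/BN/zP. Qed.

Lemma coord_inB z z' : coord_in z -> coord_in z' -> coord_in (z - z').
Proof. by move=> zP zP'; apply: coord_inD zP _; exact: coord_inN. Qed.

Lemma coord_in0 : coord_in 0.
Proof. by move=> w d wK; rewrite (tcoord0 G wK) mcoeff0. Qed.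

Lemma coord_in_sum (I : Type) (r : seq I) (P : pred I) (F : I -> M) :
  (forall i, P i -> coord_in (F i)) -> coord_in (\sum_(i <- r | P i) F i).
Proof. exact: (big_ind _ coord_in0 coord_inD). Qed.

Lemma coord_in_pureT w (e : {malg A[G]}) : w \in minreps K ->
  (forall d, B d e@_d) -> coord_in (pure (T w) e).
Proof.
move=> wK eP x d xK; rewrite (tcoord_pureT xK _ wK).
by case: ifP => // _; rewrite mcoeff0.
Qed.

End Bounds.

(** * Linear combinations with restricted coefficients *)

Section LinComb.
Variables (M : lmodType A) (C : A -> Prop) (P : M -> Prop).

Lemma lin_comb0 : lin_comb C P 0.
Proof. by exists [::]; rewrite ?big_nil. Qed.

Lemma lin_combD x y : lin_comb C P x -> lin_comb C P y -> lin_comb C P (x + y).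
Proof.
case=> [t tP ->] [t' tP' ->]; exists (t ++ t'); last by rewrite big_cat.
by move=> p; rewrite mem_cat => /orP[/tP|/tP'].
Qed.

Lemma lin_comb1 a x : C a -> P x -> lin_comb C P (a *: x).
Proof.
move=> Ca Px; exists [:: (a, x)]; last by rewrite big_seq1.
by move=> p; rewrite inE => /eqP ->.
Qed.

Lemma lin_comb_ind (Q : M -> Prop) : Q 0 -> (forall x y, Q x -> Q y -> Q (x + y)) ->
  (forall a x, C a -> P x -> Q (a *: x)) -> forall x, lin_comb C P x -> Q x.
Proof.
move=> Q0 QD QZ _ [t tP ->]; rewrite big_seq.
by apply: big_ind => // p /tP[]; exact: QZ.
Qed.

End LinComb.

(** * Coordinates of canonical basis elements *)

Section Canonical.
Variables (m : nat) (H : heckeAlgebra m) (G : wgraph H) (K : {set 'I_m.+1}).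
Local Notation M := (tensor G K).
Local Notation small := (coord_in (K := K) (fun _ : G => uVAminus)).

Lemma uVAminus_delta a (c d : G) : uVAminus a -> uVAminus (a *: << c >>)@_d.
Proof.
rewrite mcoeffZ mcoeffU; case: eqP => _ aP; first by rewrite mulr1.
by rewrite mulr0; exact: uVAminus0.
Qed.

Lemma canonical_small (C : 'S_m.+2 -> G -> M) w g : canonical_basis C ->
  w \in minreps K -> small (C w g - pure (T w) << g >>).
Proof.
case=> _ _ CP wK; move: (CP w g wK); apply: lin_comb_ind.
- by apply: coord_in0 => _; exact: uVAminus0.
- by apply: coord_inD => _; exact: uVAminusD.
move=> a _ aP [x [d [xK ->]]]; rewrite -pureZr; apply: coord_in_pureT => //.
  by move=> _; exact: uVAminus0.
by move=> d'; exact: uVAminus_delta.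
Qed.

End Canonical.

(** * Coordinates of images under $\tilde\beta$ *)

Section Projection.
Variables (m : nat) (H : heckeAlgebra m) (G : wgraph H).
Local Notation s1 := (ord0 : 'I_m.+1).
Local Notation J := (Jprime m).
Local Notation K2 := (Sminus2 m).
Local Notation AG := {malg A[G]}.
Local Notation beta := (@tproj m H G J K2).
Local Notation s1desc := (@s1desc m H G).

(** For a bar-invariant element, this bound on all coordinates forces membership in $\mathscr L^*$;
    see [bar_invariant_Lstar]. *)
Definition bound (d : G) (a : A) : Prop := if s1desc d then Aminus a else uVAminus a.

Lemma bound0 d : bound d 0.
Proof. by rewrite /bound; case: ifP => _; [exact: Aminus0|exact: uVAminus0]. Qed.

Lemma boundD d a b : bound d a -> bound d b -> bound d (a + b).
Proof. by rewrite /bound; case: ifP => _; [exact: AminusD|exact: uVAminusD]. Qed.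

Lemma boundN d a : bound d a -> bound d (- a).
Proof. by rewrite /bound; case: ifP => _; [exact: AminusN|exact: uVAminusN]. Qed.

Lemma bound_small d a : uVAminus a -> bound d a.
Proof. by rewrite /bound; case: ifP => _ // /uVAminusW. Qed.

Local Notation good := (coord_in (K := K2) bound).

Lemma beta_T e w : w \in minreps K2 -> beta (pure (T w) e) = pure (T w) e.
Proof. by move=> _; exact: (tproj_pure (Jprime_sub m)). Qed.

Lemma beta_Ts1 e w : w \in minreps K2 ->
  beta (pure (T (w * simple s1)%g) e) = pure (T w) (act (T (simple s1) : H) e).
Proof.
move=> wK; rewrite (T_minreps_s1 H wK).
apply: etrans (tproj_pure (Jprime_sub m) _ _) _; apply: pureK.
exact/in_parabolicT/parabolic_simple/s1_in_K2.
Qed.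

(** The factor $u^{-1}$ is lost only if $s_1\in L(c)$, where $T_{s_1}$ acts by u and the result
    stays at c. Otherwise the coefficients are integers and $-u^{-1}$. *)
Lemma bound_actT a c d : uVAminus a ->
  bound d (a *: act (T (simple s1) : H) << c >>)@_d.
Proof.
move=> aP; rewrite mcoeffZ coef_actT.
have [cP|cP] := boolP (s1desc c).
  case: eqP => [<-|_]; last by rewrite !mulr0; exact: bound0.
  by rewrite /bound cP mulr1; exact: Aminus_u.
apply: bound_small; rewrite mulrBr; apply: uVAminusD.
  by case: ifP => _; [exact: uVAminusMint|rewrite mulr0; exact: uVAminus0].
apply: uVAminusN; case: eqP => _; last by rewrite !mulr0; exact: uVAminus0.
by rewrite mulr1; exact: uVAminusMuV.
Qed.

(** This controls the lower terms of a canonical basis element. Each x in the sum is w or $ws_1$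
    with w in $W^{S\setminus s_2}$; in the second case $T_{s_1}$ crosses the tensor sign. *)
Lemma beta_good z :
  lin_comb uVAminus
    (fun y => exists x d, x \in minreps J /\ y = pure (T x) << d >>) z ->
  good (beta z).
Proof.
have bD := tprojD (Jprime_sub m) (G := G); have bZ := tprojZ (Jprime_sub m) (G := G).
move: z; apply: lin_comb_ind.
- have -> : beta 0 = 0 by have := bZ 0 0; rewrite !scale0r.
  exact: (coord_in0 bound0).
- move=> x y xP yP; have -> : beta (x + y) = beta x + beta y by exact: bD.
  exact: (coord_inD boundD).
move=> a _ aP [x [d [xJ ->]]].
have -> : beta (a *: pure (T x) << d >>) = a *: beta (pure (T x) << d >>) by exact: bZ.
have [xK|[w wK ->]] := minrepsJ_cases H xJ.
  have -> := beta_T << d >> xK; rewrite -pureZr.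
  apply: (coord_in_pureT bound0 xK) => d'; apply: bound_small.
  exact: uVAminus_delta.
have -> := beta_Ts1 << d >> wK; rewrite -pureZr.
by apply: (coord_in_pureT bound0 wK) => d'; exact: bound_actT.
Qed.

End Projection.

(** * Bar-invariant elements and $\mathscr L^*$ *)

Section BarInvariant.
Variables (m : nat) (H : heckeAlgebra m) (G : wgraph H).
Local Notation s1 := (ord0 : 'I_m.+1).
Local Notation K2 := (Sminus2 m).
Local Notation s1desc := (@s1desc m H G).
Local Notation good := (coord_in (K := K2) (@bound m H G)).
Local Notation small := (coord_in (K := K2) (fun _ : G => uVAminus)).
Variable C2 : 'S_m.+2 -> G -> tensor G K2.
Hypothesis can2 : canonical_basis C2.

Lemma good_supp z : good z -> tbar z = z ->
  forall w, w \in minreps K2 -> supp_in s1desc (tcoord w z).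
Proof.
move=> zP zbar; apply: bar_invariant_supp zbar _ => [k e|w d wK dP].
  exact: supp_s1desc_act.
by have := zP w d wK; rewrite /bound (negPf dP).
Qed.

(** Let y combine the canonical basis with the constant terms of the coordinates of z as
    coefficients. By [good_supp] only vertices with $s_1$ as a descent occur, and z - y is
    bar-invariant with coordinates in $u^{-1}A^-$, hence 0. *)
Lemma bar_invariant_Lstar z : good z -> tbar z = z -> Lstar C2 z.
Proof.
move=> zP zbar; have supp := good_supp zP zbar.
have [_ C2bar _] := can2.
pose n x d := coefu 0 (tcoord x z)@_d.
pose y := \sum_(x in minreps K2) \sum_(d <- msupp (tcoord x z)) (n x d)%:~R *: C2 x d.
have yL : Lstar C2 y.
  apply: big_ind => [||x xK]; [exact: lin_comb0|exact: lin_combD|].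
  rewrite big_seq; apply: big_ind => [||d]; [exact: lin_comb0|exact: lin_combD|].
  rewrite -mcoeff_neq0 => d0; apply: lin_comb1; first exact: Aminus_int.
  exists x, d; split=> //; apply: contraNT d0 => dP; apply/eqP.
  exact: (supp x xK d dP).
have ybar : tbar y = y.
  rewrite /y tbar_sum; apply: eq_bigr => x xK; rewrite tbar_sum.
  by apply: eq_bigr => d _; rewrite tbarZ rmorph_int (C2bar x d xK).
suff zy : z - y = 0 by rewrite (subr0_eq zy).
have zybar : tbar (z - y) = z - y by rewrite tbarB zbar ybar.
suff zyP : small (z - y).
  exact: (bar_invariant_eq0 zybar).
(* [y'] replaces each canonical basis element in [y] by its leading term: z - y' is small by
   [int_part], y - y' by the congruence defining the canonical basis. *)
pose y' := \sum_(x in minreps K2)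
  pure (T x) (\sum_(d <- msupp (tcoord x z)) (n x d)%:~R *: << d >>) : tensor G K2.
have -> : z - y = (z - y') - (y - y') by rewrite opprB addrA subrK.
apply: (coord_inB (fun _ => @uVAminusD) (fun _ => @uVAminusN)).
  move=> w d wK; rewrite (tcoordB wK) mcoeffB.
  have coef_w : (\sum_(c <- msupp (tcoord w z)) (n w c)%:~R *: << c >>)@_d
      = (n w d)%:~R :> A.
    rewrite mcoeff_sum; have [dz|dz] := boolP (d \in msupp (tcoord w z)).
      rewrite (big_fsetD1 d dz) /= big1_seq => [|c /andP[_]].
        by rewrite addr0 mcoeffZ mcoeffUU mulr1.
      by rewrite !inE => /andP[cd _]; rewrite mcoeffZ mcoeffU (negPf cd) mulr0.
    rewrite {2}/n (mcoeff_outdom dz) coefu0 big_seq big1 // => c cz.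
    rewrite mcoeffZ mcoeffU; case: eqP => [cd|_]; last by rewrite mulr0.
    by rewrite -cd cz in dz.
  have y'_w : tcoord w y' = \sum_(c <- msupp (tcoord w z)) (n w c)%:~R *: << c >>.
    exact: (tcoord_sumT
      (fun x => \sum_(c <- msupp (tcoord x z)) (n x c)%:~R *: << c >>) wK).
  rewrite y'_w coef_w.
  apply: int_part; have := zP w d wK; rewrite /bound.
  by case: ifP => _ // /uVAminusW.
rewrite /y /y' -sumrB.
apply: (coord_in_sum (fun _ => uVAminus0) (fun _ => @uVAminusD)) => x xK.
rewrite pure_sumr -sumrB.
apply: (coord_in_sum (fun _ => uVAminus0) (fun _ => @uVAminusD)) => d _.
rewrite pureZr -scalerBr => w d' wK; rewrite (tcoordZ wK) mcoeffZ mulrC.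
exact/uVAminusMint/(canonical_small d can2 xK).
Qed.

End BarInvariant.

(** * A map back to the tensor product over $J'_{n-2}$ *)

Section Alpha.
Variables (m : nat) (H : heckeAlgebra m) (G : wgraph H).
Local Notation s1 := (ord0 : 'I_m.+1).
Local Notation J := (Jprime m).
Local Notation K2 := (Sminus2 m).
Local Notation AG := {malg A[G]}.
Local Notation C := (Cs H s1).
Local Notation beta := (@tproj m H G J K2).

(** On the [2]-eigenspace of $C'_{s_1}$ the last two terms cancel and this is $h\boxtimes e\mapsto
    hC'_{s_1}\boxtimes e$; the correction makes the map balanced on all of $A\Gamma$. *)
Definition alpha_pure (p : H * AG) : tensor G J :=
  pure (p.1 * C) p.2 + pure p.1 (act C p.2) - qtwo *: pure p.1 p.2.

Definition alpha : tensor G K2 -> tensor G J := tlift idfun alpha_pure.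

Let add3 (V : zmodType) (a a' b b' c c' : V) :
  (a + a') + (b + b') - (c + c') = (a + b - c) + (a' + b' - c').
Proof. by rewrite (addrACA a) opprD [LHS]addrACA. Qed.

(** Balance over S \ s_2 is checked on $\mathscr H_{J'_{n-2}}$, which commutes with $C'_{s_1}$, and
    on $C'_{s_1}$ itself. *)
Lemma alpha_pureP :
  [/\ forall h h' e, alpha_pure (h + h', e) = alpha_pure (h, e) + alpha_pure (h', e),
      forall h e e', alpha_pure (h, e + e') = alpha_pure (h, e) + alpha_pure (h, e'),
      forall a h e, alpha_pure (a *: h, e) = a *: alpha_pure (h, e),
      forall a h e, alpha_pure (h, a *: e) = a *: alpha_pure (h, e) &
      forall h k e, in_parabolic K2 k -> alpha_pure (h * k, e) = alpha_pure (h, act k e)].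
Proof.
have fDl h h' e : alpha_pure (h + h', e) = alpha_pure (h, e) + alpha_pure (h', e).
  by rewrite /alpha_pure /= mulrDl !pureDl scalerDr; exact: add3.
have fDr h e e' : alpha_pure (h, e + e') = alpha_pure (h, e) + alpha_pure (h, e').
  by rewrite /alpha_pure /= actDr !pureDr scalerDr; exact: add3.
have fZl a h e : alpha_pure (a *: h, e) = a *: alpha_pure (h, e).
  rewrite /alpha_pure /= -scalerAl !pureZl scalerBr scalerDr.
  by rewrite scalerA mulrC -scalerA.
have fZr a h e : alpha_pure (h, a *: e) = a *: alpha_pure (h, e).
  have e1 : pure (h * C) (a *: e) = a *: pure (h * C) e :> tensor G J by exact: pureZr.
  have e2 : pure h (act C (a *: e)) = a *: pure h (act C e) :> tensor G J.
    by rewrite actZr; exact: pureZr.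
  have e3 : pure h (a *: e) = a *: pure h e :> tensor G J by exact: pureZr.
  apply: etrans (congr2 (fun x y => x - qtwo *: y) (congr2 +%R e1 e2) e3) _.
  by rewrite /alpha_pure scalerBr scalerDr !scalerA [a * qtwo]mulrC.
(* Both sides equal $hC'_{s_1}\boxtimes C'_{s_1}e$, the other two terms cancelling by
   $C'^2_{s_1}=[2]C'_{s_1}$. *)
have fC h e : alpha_pure (h * C, e) = alpha_pure (h, act C e).
  have e1 : pure (h * C * C) e = qtwo *: pure (h * C) e :> tensor G J.
    by rewrite -mulrA Cs_sqr -scalerAr; exact: pureZl.
  have e2 : pure h (act C (act C e)) = qtwo *: pure h (act C e) :> tensor G J.
    by rewrite -Defs.actM Cs_sqr actZl; exact: pureZr.
  rewrite /alpha_pure /= e1 e2 addrAC subrr add0r; exact/esym/addrK.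
have fJ h k e : in_parabolic J k -> alpha_pure (h * k, e) = alpha_pure (h, act k e).
  move=> kJ; rewrite /alpha_pure /=.
  have e1 : pure (h * k * C) e = pure (h * C) (act k e) :> tensor G J.
    by rewrite -mulrA -(Cs_commJ kJ) mulrA; exact: pureK.
  have e2 : pure (h * k) (act C e) = pure h (act C (act k e)) :> tensor G J.
    have <- : act k (act C e) = act C (act k e).
      apply: etrans (esym (Defs.actM _ _ _)) _; apply: esym.
      exact: etrans (esym (Defs.actM _ _ _)) (congr1 (fun x => act x e) (Cs_commJ kJ)).
    exact: pureK.
  have e3 : pure (h * k) e = pure h (act k e) :> tensor G J by exact: pureK.
  by apply: etrans (congr2 (fun x y => x - qtwo *: y) (congr2 +%R e1 e2) e3) _.
split; [exact: fDl|exact: fDr|exact: fZl|exact: fZr|move=> h k e kK].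
move: k kK h e; apply: in_parabolicK2_ind => [k k' kP kP'|k kJ|k kJ] h e.
- rewrite mulrDr actDl; apply: etrans (fDl _ _ _) _; apply: etrans _ (esym (fDr _ _ _)).
  exact: (congr2 (@GRing.add (tensor G J)) (kP h e) (kP' h e)).
- exact: fJ.
rewrite mulrA Defs.actM; apply: etrans (fC _ _) _; exact: fJ.
Qed.

Lemma alphaD : {morph alpha : z z' / z + z'}.
Proof.
case: alpha_pureP => fDl fDr fZl fZr fK.
exact: (tliftD (sigma := idfun) (f := alpha_pure) fDl fDr fZl fZr fK).
Qed.

Lemma alphaE h e : alpha (pure h e) = alpha_pure (h, e).
Proof.
case: alpha_pureP => fDl fDr fZl fZr fK.
exact: (tlift_pure (sigma := idfun) (f := alpha_pure) fDl fDr fZl fZr fK).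
Qed.

Lemma alpha0 : alpha 0 = 0.
Proof.
by apply: (addrI (alpha 0)); apply: etrans (esym (alphaD _ _)) _; rewrite !addr0.
Qed.

Lemma alpha_sum (I : Type) (r : seq I) (P : pred I) (F : I -> tensor G K2) :
  alpha (\sum_(i <- r | P i) F i) = \sum_(i <- r | P i) alpha (F i).
Proof. exact: (big_morph alpha alphaD alpha0). Qed.

Lemma alpha_tbar z : alpha (tbar z) = tbar (alpha z).
Proof.
move: z; apply: tensor_ind => [h e|z z' zE zE'].
  have -> : alpha (pure h e) = alpha_pure (h, e) by exact: alphaE.
  have -> : tbar (pure h e) = pure (hbar h) (gbar e) :> tensor G K2 by exact: tbar_pure.
  have e1 : tbar (pure (h * C) e) = pure (hbar h * C) (gbar e) :> tensor G J.
    by apply: etrans (tbar_pure _ _ _) _; rewrite hbarM hbar_Cs.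
  have e2 : tbar (pure h (act C e)) = pure (hbar h) (act C (gbar e)) :> tensor G J.
    exact: etrans (tbar_pure _ _ _) (congr1 (pure (hbar h)) (gbar_actCs _ _)).
  have e3 : tbar (qtwo *: pure h e) = qtwo *: pure (hbar h) (gbar e) :> tensor G J.
    apply: etrans (tbarZ _ _) _; rewrite lbar_qtwo.
    exact: (congr1 (fun x => qtwo *: x) (tbar_pure J h e)).
  pose sub := fun x y : tensor G J => x - y.
  apply: etrans (alphaE _ _) _; apply: esym; apply: etrans (tbarB _ _) _.
  exact: (congr2 sub (etrans (tbarD _ _) (congr2 (@GRing.add (tensor G J)) e1 e2)) e3).
have -> : tbar (z + z') = tbar z + tbar z' by exact: tbarD.
apply: etrans (alphaD _ _) _.
apply: etrans (congr2 (@GRing.add (tensor G J)) zE zE') _.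
apply: etrans (esym (tbarD _ _)) _.
exact: (congr1 (@tbar m H G J) (esym (alphaD z z'))).
Qed.

Lemma alpha_supp h e : supp_in (@s1desc m H G) e ->
  alpha (pure h e) = pure (h * C) e.
Proof.
move=> /supp_s1descP eE; apply: etrans (alphaE _ _) _; rewrite /alpha_pure /= eE.
by rewrite pureZr addrK.
Qed.

(** Over S \ s_2 the factor $C'_{s_1}$ crosses the tensor sign and acts on e by [2]; with
    [alpha_supp], beta after alpha is multiplication by [2] here. *)
Lemma beta_alpha_supp h e : supp_in (@s1desc m H G) e ->
  beta (pure (h * C) e) = qtwo *: pure h e.
Proof.
move=> /supp_s1descP eE; apply: etrans (tproj_pure (Jprime_sub m) _ _) _.
apply: etrans (pureK _ _ (in_parabolic_Cs H)) _; rewrite eE; exact: pureZr.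
Qed.

End Alpha.

(** * Images of canonical basis elements *)

Section CanonicalImages.
Variables (m : nat) (H : heckeAlgebra m) (G : wgraph H).
Local Notation s1 := (ord0 : 'I_m.+1).
Local Notation J := (Jprime m).
Local Notation K2 := (Sminus2 m).
Local Notation s1desc := (@s1desc m H G).
Local Notation beta := (@tproj m H G J K2).
Local Notation good := (coord_in (K := K2) (@bound m H G)).
Local Notation small K := (coord_in (K := K) (fun _ : G => uVAminus)).
Variables (C1 : 'S_m.+2 -> G -> tensor G J) (C2 : 'S_m.+2 -> G -> tensor G K2).
Hypotheses (can1 : canonical_basis C1) (can2 : canonical_basis C2).

Lemma small_good z : small K2 z -> good z.
Proof. by move=> zP w d wK; apply/bound_small/zP. Qed.

Lemma Aminus_delta (c d : G) : Aminus (<< c >> : {malg A[G]})@_d.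
Proof. by rewrite mcoeffU; exact: (Aminus_int (c == d)). Qed.

Lemma good_T w g : w \in minreps K2 -> s1 \in desc g -> good (pure (T w) << g >>).
Proof.
move=> wK gs; apply: (coord_in_pureT (@bound0 m H G) wK) => d; rewrite /bound.
case: ifPn => [_|dP]; first exact: Aminus_delta.
rewrite mcoeffU; case: eqP => [gd|_]; last exact: uVAminus0.
by case/negP: dP; rewrite -gd.
Qed.

Lemma good_C2 w g : w \in minreps K2 -> s1 \in desc g -> good (C2 w g).
Proof.
move=> wK gs; rewrite -(subrK (pure (T w) << g >>) (C2 w g)).
apply: (coord_inD (@boundD m H G)); last exact: good_T.
exact/small_good/(canonical_small g can2 wK).
Qed.

Lemma beta_tbar_C1 x g : x \in minreps J -> tbar (beta (C1 x g)) = beta (C1 x g).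
Proof.
move=> xJ; have [_ C1bar _] := can1.
have -> : tbar (beta (C1 x g)) = beta (tbar (C1 x g)).
  exact/esym/tproj_tbar/Jprime_sub.
exact: congr1 (C1bar x g xJ).
Qed.

(** The lower terms are covered by [beta_good], so only the leading term has to be examined. *)
Lemma beta_C1_good x g : x \in minreps J ->
  good (beta (pure (T x) << g >>)) -> good (beta (C1 x g)).
Proof.
move=> xJ gP; have [_ _ C1P] := can1.
have -> : beta (C1 x g) = beta (C1 x g - pure (T x) << g >>) + beta (pure (T x) << g >>).
  rewrite -{1}(subrK (pure (T x) << g >>) (C1 x g)).
  exact: (tprojD (Jprime_sub m)).
apply: (coord_inD (@boundD m H G)) gP; exact/beta_good/C1P.
Qed.

(** By uniqueness of bar-invariant elements with a given leading term, alpha sends $\tilde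
    C'_{w,\gamma}$ to $\tilde C'_{ws_1,\gamma}$; beta then multiplies by [2], all coordinates being
    supported on descent vertices of $s_1$. *)
Lemma beta_C1_s1desc w g : w \in minreps K2 -> s1 \in desc g ->
  beta (C1 (w * simple s1)%g g) = qtwo *: C2 w g.
Proof.
move=> wK gs; have [_ C1bar _] := can1; have [_ C2bar _] := can2.
have supp := good_supp (good_C2 wK gs) (C2bar w g wK).
pose e x := tcoord x (C2 w g).
(* [e'] holds the coordinates of the leading term $T_w\boxtimes\gamma$. *)
pose e' x : {malg A[G]} := if x == w then << g >> else 0.
have zE : C2 w g = \sum_(x in minreps K2) pure (T x) (e x) by exact: tensor_decomp.
have azE : alpha (C2 w g) = \sum_(x in minreps K2) pure (T x * Cs H s1) (e x).
  rewrite {1}zE; apply: etrans (alpha_sum _ _ _) _; apply: eq_bigr => x xK.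
  exact/alpha_supp/supp.
have e_small x d : x \in minreps K2 -> uVAminus (e x - e' x)@_d.
  move=> xK; have := canonical_small g can2 wK d xK; rewrite (tcoordB xK).
  have -> : tcoord x (pure (T w) << g >> : tensor G K2) = e' x.
    by apply: etrans (tcoord_pureT xK _ wK) _; rewrite /e' eq_sym.
  exact: id.
have e_Aminus x d : x \in minreps K2 -> Aminus (e x)@_d.
  move=> xK; rewrite -(subrK (e' x) (e x)) mcoeffD; apply: AminusD.
    exact/uVAminusW/e_small.
  by rewrite /e'; case: ifP => _; [exact: Aminus_delta|rewrite mcoeff0; exact: Aminus0].
have T_small : small J (alpha (C2 w g) - pure (T (w * simple s1)%g) << g >>).
  have -> : pure (T (w * simple s1)%g) << g >>
      = \sum_(x in minreps K2) pure (T (x * simple s1)%g) (e' x) :> tensor G J.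
    rewrite (bigD1 w wK) big1 => [|x /andP[_ xw]].
      by rewrite /= addr0 /e' eqxx.
    by rewrite /e' (negPf xw); exact: pure0r.
  rewrite azE -sumrB; apply: (coord_in_sum (fun _ => uVAminus0) (fun _ => @uVAminusD)).
  move=> x xK.
  (* Expand $C'_{s_1}=T_{s_1}+u^{-1}$: the second term is small because the coordinates lie in
     $A^-$, the first because only e x - e' x remains. *)
  have -> : pure (T x * Cs H s1) (e x)
      = pure (T (x * simple s1)%g) (e x) + pure (T x) (upow (-1) *: e x) :> tensor G J.
    rewrite /Cs mulrDr -(T_minreps_s1 H xK) -scalerAr mulr1.
    have e1 : pure (upow (-1) *: T x) (e x) = pure (T x) (upow (-1) *: e x) :> tensor G J.
      exact: etrans (pureZl _ _ _ _) (esym (pureZr _ _ _ _)).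
    exact: etrans (pureDl _ _ _ _) (congr1 (@GRing.add (tensor G J) _) e1).
  rewrite addrAC.
  have -> : pure (T (x * simple s1)%g) (e x) - pure (T (x * simple s1)%g) (e' x)
      = pure (T (x * simple s1)%g) (e x - e' x) :> tensor G J.
    have e1 : pure (T (x * simple s1)%g) (- e' x)
        = - pure (T (x * simple s1)%g) (e' x) :> tensor G J.
      by rewrite -!scaleN1r; exact: pureZr.
    exact: esym (etrans (pureDr _ _ _ _) (congr1 (@GRing.add (tensor G J) _) e1)).
  apply: (coord_inD (fun _ => @uVAminusD)).
    apply: (coord_in_pureT (fun _ => uVAminus0) (minreps_s1 H xK)) => d.
    exact: e_small.
  apply: (coord_in_pureT (fun _ => uVAminus0) (minrepsK2_J xK)) => d.
  by rewrite mcoeffZ; apply/uVAminus_uV/e_Aminus.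
have wJ := minreps_s1 H wK.
have aC1 : alpha (C2 w g) = C1 (w * simple s1)%g g.
  apply: subr0_eq; apply: bar_invariant_eq0.
    by rewrite tbarB -alpha_tbar (C2bar w g wK) (C1bar _ g wJ).
  have := coord_inB (fun _ => @uVAminusD) (fun _ => @uVAminusN) T_small
    (canonical_small g can1 wJ).
  by rewrite opprB addrA subrK.
rewrite -aC1 azE zE scaler_sumr.
have bsum := big_morph beta (tprojD (Jprime_sub m)) (id1 := 0) (id2 := 0).
apply: etrans (bsum _ _ _ _ _) _.
  by have := tprojZ (G := G) (Jprime_sub m) 0 0; rewrite !scale0r.
apply: eq_bigr => x xK; exact/beta_alpha_supp/supp.
Qed.

End CanonicalImages.

(** * The four formulas for $\tilde\beta$ *)

Theorem theorem8p8 (m : nat) (H : heckeAlgebra m) (G : wgraph H)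
    (C1 : 'S_m.+2 -> G -> tensor G (Jprime m))
    (C2 : 'S_m.+2 -> G -> tensor G (Sminus2 m)) :
  canonical_basis C1 -> canonical_basis C2 ->
  let s1 : 'I_m.+1 := ord0 in
  let beta := @tproj m H G (Jprime m) (Sminus2 m) in
  forall (w : 'S_m.+2) (gamma : G), w \in minreps (Sminus2 m) ->
    [/\ s1 \in desc gamma ->
          beta (C1 (w * simple s1)%g gamma) = qtwo *: C2 w gamma,
        s1 \in desc gamma -> Lstar C2 (beta (C1 w gamma)),
        s1 \notin desc gamma -> Lstar C2 (beta (C1 (w * simple s1)%g gamma))
      & s1 \notin desc gamma -> Lstar C2 (beta (C1 w gamma) - C2 w gamma)].
Proof.
move=> can1 can2 s1 beta w g wK.
have wJ := minrepsK2_J wK; have wsJ := minreps_s1 H wK.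
split=> gs; first exact: beta_C1_s1desc.
- apply: (bar_invariant_Lstar can2); last exact: beta_tbar_C1.
  apply: (beta_C1_good can1 wJ); have -> := beta_T << g >> wK.
  exact: good_T.
- apply: (bar_invariant_Lstar can2); last exact: beta_tbar_C1.
  apply: (beta_C1_good can1 wsJ); have -> := beta_Ts1 << g >> wK.
  apply: (coord_in_pureT (@bound0 m H G) wK) => d.
  (* $T_{s_1}\gamma=C'_{s_1}\gamma-u^{-1}\gamma$ has integer coefficients at vertices with $s_1$ as
     a descent and $-u^{-1}$ at $\gamma$, which is not one of them. *)
  rewrite coef_actT (negPf (gs : ~~ s1desc g)) /bound.
  case: ifP => ds.
    have -> : (g == d) = false by apply: contraNF gs => /eqP ->.
    by rewrite ds mulr0 subr0; exact: Aminus_int.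
  rewrite ds sub0r; apply/uVAminusN/uVAminus_uV; exact: (Aminus_int (g == d)).
have [_ C2bar C2P] := can2; have [_ _ C1P] := can1.
apply: (bar_invariant_Lstar can2); last first.
  by rewrite tbarB (beta_tbar_C1 can1 g wJ) (C2bar w g wK).
(* The leading terms $T_w\boxtimes\gamma$ agree and cancel, leaving lower terms only. *)
have -> : beta (C1 w g) - C2 w g
    = beta (C1 w g - pure (T w) << g >>) - (C2 w g - pure (T w) << g >>).
  have -> : beta (C1 w g) = beta (C1 w g - pure (T w) << g >>) + pure (T w) << g >>.
    rewrite -(beta_T << g >> wK) -{1}(subrK (pure (T w) << g >>) (C1 w g)).
    exact: (tprojD (Jprime_sub m)).
  by rewrite opprB addrA.
apply: (coord_inB (@boundD m H G) (@boundN m H G)).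
  exact/beta_good/C1P.
exact/small_good/(canonical_small g can2 wK).
Qed.
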